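(* Let $L$ be an ordered (classical or virtual) tangle on $n$ strings, let $j\in\{1,\dots,n\}$, and let $G$ be a Gauss diagram of $L$. Then $Z_j(L):=Z_j(G)=\sum_{A\in\mathcal A_j}\operatorname{sign}(A)\,\langle A,G\rangle\,[T_A]\in \mathrm{Dias}$ is an invariant of ordered tangles; that is, $Z_j(G)$ depends only on the ordered tangle $L$ and not on the choice of its Gauss diagram $G$ (equivalently, $Z_j(G)$ is unchanged when $G$ is modified by Reidemeister moves of Gauss diagrams).
   Context: **Tangles.** Let $D^2$ be a disk in the $xy$-plane with prescribed interior points $p_1,p_2,\dots$ on the $x$-axis, and $C=D^2\times[0,1]$. An (ordered, oriented) $(k,l)$-tangle (without closed components) is an ordered collection of $n=\frac12(k+l)$ disjoint oriented intervals (strings) properly embedded in $C$ with endpoints in $\{p_i\}_{i=1}^k\times\{1\}\cup\{p_i\}_{i=1}^l\times\{0\}$, up to oriented isotopy of $C$ fixed on the boundary. A tangle diagram is a generic projection to the $xz$-plane with over/under information. **Gauss diagrams.** The Gauss diagram of a tangle diagram is an ordered collection of $n$ oriented intervals (the strings), with the two preimages of each crossing joined by an arrow, pointing from the over-passing point to the under-passing point and carrying the sign $\pm1$ (local writhe) of the crossing. An abstract (virtual) Gauss diagram is any ordered collection of $n$ oriented intervals with finitely many signed arrows with distinct endpoints on the intervals. Reidemeister moves of Gauss diagrams are: $\Omega1$: insertion/deletion of an arrow (any sign, any direction) whose two endpoints are adjacent on one string. $\Omega2$: insertion/deletion of two arrows of opposite signs whose tails are adjacent on one string fragment and whose heads are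 adjacent on another string fragment (the two orders of the heads relative to the tails are both allowed). $\Omega3$: given three string fragments $t,m,b$ and three arrows $t\to m$, $t\to b$, $m\to b$, all of sign $+1$, such that, following orientations, on $t$ the endpoint of $t\to m$ is immediately before that of $t\to b$, on $m$ the endpoint of $t\to m$ is immediately before that of $m\to b$, and on $b$ the endpoint of $t\to b$ is immediately before that of $m\to b$: simultaneously reverse these three adjacent pairs (and the inverse move). Fragments may belong to the same or different strings, ordered arbitrarily. Gauss diagrams of isotopic classical tangles are related by these moves; a virtual tangle is an equivalence class of abstract Gauss diagrams modulo these moves. **Arrow diagrams and pairing.** An arrow diagram on $n$ strings is an ordered set of $n$ oriented intervals with several (unsigned) arrows connecting pairs of distinct points on them, up to orientation-preserving diffeomorphism of the intervals. For an arrow diagram $A$ on $n$ strings and a Gauss diagram $G$ with $n$ strings, $\langle A,G\rangle=\sum_{\phi:A\to G}\operatorname{sign}(\phi)$, where $\phi$ runs over embeddings of $A$ into $G$ mapping the $i$-th string to the $i$-th string and arrows to arrows, preserving orientations (i.e. over the subsets of arrows of $G$ which, after forgetting signs, form the diagram $A$), and $\operatorname{sign}(\phi)=\prod_{a\in A}\operatorname{sign}(\phi(a))$. **Tree diagrams.** Let $j\in\{1,\dots,n\}$ and $I\subset\{1,\dots,n\}\setminus\{j\}$. A tree diagram with leaves on $I$ and trunk on $j$ is an arrow diagram on $n$ strings such that: the tail and the head of every arrow lie on different strings; there is exactly one arrow with tail on the $i$-th string if $i\in I$ and none if $i\notin I$; all arrowheads lie on strings numbered by $I\cup\{j\}$;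 on each string $i\in I$ all arrowheads precede the unique arrowtail. Regard the diagram $A$ as a graph, remove all strings not in $I\cup\{j\}$ and cut off the part of each string $i\in I$ after its arrowtail; the resulting graph $T_A$ is a tree, with leaves at the beginnings of the strings in $I\cup\{j\}$ and root at the endpoint of the $j$-th string. $A$ is planar if $T_A$ can be drawn in the plane so that, counting leaves clockwise starting from the root, they appear in the increasing order of the indices in $I\cup\{j\}$. $\mathcal A_{I,j}$ is the set of planar tree diagrams with leaves on $I$ and trunk on $j$, and $\mathcal A_j=\bigcup_I\mathcal A_{I,j}$. The sign of an arrow diagram $A$ is $\operatorname{sign}(A)=(-1)^q$, where $q$ is the number of right-pointing arrows (arrows from the $p$-th to the $s$-th string with $p<s$). **Diassociative relations.** A planar tree $T_A$ is viewed as a parenthesized monomial in operations $\vdash,\dashv$ in its leaves (in increasing order, each once): at a vertex where an arrow with tail on string $q$ hits string $p$, the branch $y$ coming along the arrow and the branch $x$ coming along string $p$ are combined as $x\dashv y$ if $q>p$ and as $y\vdash x$ if $q<p$. $\mathrm{Dias}(m)$ is the quotient of the free abelian group on such planar trees with $m$ leaves by the relations (applied at any place inside a tree) of a diassociative algebra: (1) $(x\dashv y)\dashv z=x\dashv(y\vdash z)$; (2) $(x\dashv y)\dashv z=x\dashv(y\dashv z)$; (3) $(x\vdash y)\dashv z=x\vdash(y\dashv z)$; (4) $(x\dashv y)\vdash z=x\vdash(y\vdash z)$; (5) $(x\vdash y)\vdash z=x\vdash(y\vdash z)$. $[T_A]$ denotes the class of $T_A$; the set $I\cup\{j\}$ of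 leaf labels is regarded as part of the data, so that trees with different leaf sets are independent and $Z_j(G)$ takes values in the direct sum over $I$ of copies of $\mathrm{Dias}(|I|+1)$. *)

(* Defs.v *)
From HB Require Import structures.
From mathcomp Require Import all_boot all_order all_algebra.
From mathcomp Require Import finmap freeg boolp.
From Stdlib Require Import Relation_Operators.

Set Implicit Arguments.
Unset Strict Implicit.
Unset Printing Implicit Defensive.

Import GRing.Theory.

Local Open Scope fset_scope.
Local Open Scope ring_scope.

                                       

                                                                       
                                                                            
                                                                
                                                                      
Notation point n := ('I_n * nat)%type.

Definition str (n : nat) (p : point n) : 'I_n := p.1.
Definition pos (n : nat) (p : point n) : nat := p.2.

                                        
Notation arrow n := (point n * point n)%type.

Definition tl (n : nat) (a : arrow n) : point n := a.1.
Definition hd (n : nat) (a : arrow n) : point n := a.2.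

Definition endpoints (n : nat) (s : seq (arrow n)) : seq (point n) :=
  flatten [seq [:: tl a; hd a] | a <- s].

                       

                                                                          
Notation sarrow n := (arrow n * bool)%type.

Definition unsign (n : nat) (a : sarrow n) : arrow n := a.1.
Definition sgnz (b : bool) : int := if b then 1 else -1.

Record gauss (n : nat) := Gauss {
  garrows :> {fset sarrow n};
  gauss_uniq : uniq (endpoints [seq unsign a | a <- garrows])
}.

Definition gendpoints (n : nat) (G : gauss n) : seq (point n) :=
  endpoints [seq unsign a | a <- garrows G].

                                                           
Definition gauss_iso (n : nat) (G G' : gauss n) : Prop :=
  exists f : point n -> point n,
    [/\ forall p, str (f p) = str p,
        {in gendpoints G &, forall p q,
           str p = str q -> (pos p < pos q)%N -> (pos (f p) < pos (f q))%N}
      & garrows G' =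
        [fset ((f (tl (unsign a)), f (hd (unsign a))), a.2) | a in garrows G]].

                                                          
Definition just_before (n : nat) (G : gauss n) (p q : point n) : bool :=
  [&& str p == str q, (pos p < pos q)%N &
      ~~ has (fun r => (str r == str p) && (pos p < pos r < pos q)%N)
             (gendpoints G)].

Definition adjacent (n : nat) (G : gauss n) (p q : point n) : bool :=
  just_before G p q || just_before G q p.

                           

                                                                          
                                                                            
Definition omega1 (n : nat) (G G' : gauss n) : Prop :=
  exists a : sarrow n,
    [/\ a \in garrows G',
        adjacent G' (tl (unsign a)) (hd (unsign a))
      & garrows G = garrows G' `\ a].

Definition omega2 (n : nat) (G G' : gauss n) : Prop :=
  exists a b : sarrow n,
    [/\ a \in garrows G' /\ b \in garrows G',
        a.2 != b.2,
        adjacent G' (tl (unsign a)) (tl (unsign b)),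
        adjacent G' (hd (unsign a)) (hd (unsign b))
      & garrows G = garrows G' `\` [fset a; b]].

                                                                         
               
Definition omega3 (n : nat) (G G' : gauss n) : Prop :=
  exists t1 t2 m1 m2 b1 b2 : point n,
    let before : {fset sarrow n} :=
      [fset ((t1, m1), true); ((t2, b1), true); ((m2, b2), true)] in
    let after : {fset sarrow n} :=
      [fset ((t2, m2), true); ((t1, b2), true); ((m1, b1), true)] in
    [/\ before `<=` garrows G,
        [/\ just_before G t1 t2, just_before G m1 m2 & just_before G b1 b2]
      & garrows G' = (garrows G `\` before) `|` after].

Definition reidemeister_step (n : nat) (G G' : gauss n) : Prop :=
  [\/ gauss_iso G G', omega1 G G', omega2 G G' | omega3 G G'].

                                                             
Definition reidemeister (n : nat) : gauss n -> gauss n -> Prop :=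
  clos_refl_sym_trans (gauss n) (@reidemeister_step n).

                       

                                                                         
                                                                            
                                                 
Definition rank (n : nat) (A : {fset arrow n}) (p : point n) : point n :=
  (str p, count (fun q => (str q == str p) && (pos q < pos p)%N) (endpoints A)).

Definition normal_form (n : nat) (A : {fset arrow n}) : {fset arrow n} :=
  [fset (rank A (tl a), rank A (hd a)) | a in A].

                                                                             
Definition arrow_diagram (n : nat) (A : {fset arrow n}) : bool :=
  uniq (endpoints A) && (normal_form A == A).

Definition forget (n : nat) (S : {fset sarrow n}) : {fset arrow n} :=
  [fset unsign a | a in S].

Definition pairing (n : nat) (A : {fset arrow n}) (G : gauss n) : int :=
  \sum_(S <- fpowerset (garrows G) | normal_form (forget S) == A)
    \prod_(a <- S) sgnz a.2.

Definition sign_diagram (n : nat) (A : {fset arrow n}) : int :=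
  (-1) ^+ count (fun a => (str (tl a) < str (hd a))%N) A.

                      

                                                       
Definition arrow_rel (n : nat) (A : {fset arrow n}) : rel 'I_n :=
  fun p q => has (fun a => (str (tl a) == p) && (str (hd a) == q)) A.

                                                                       
                                                                             
                                                                         
                                                                            
                                                           
Definition tree_diagram (n : nat) (I : {set 'I_n}) (j : 'I_n)
    (A : {fset arrow n}) : bool :=
  [&& arrow_diagram A,
      all (fun a => str (tl a) != str (hd a)) A,
      [forall i, count (fun a => str (tl a) == i) A == (i \in I)],
      all (fun a => str (hd a) \in j |: I) A,
      all (fun a => all (fun b => (str (hd b) == str (tl a)) ==>
                                  (pos (hd b) < pos (tl a))%N) A) A
    & [forall i in I, connect (arrow_rel A) i j]].

                                                                           
                                           
Inductive rtree (n : nat) : Type :=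
  | Leaf of 'I_n
  | Vertex of rtree n & rtree n.

Fixpoint trunk (n : nat) (t : rtree n) : 'I_n :=
  match t with Leaf i => i | Vertex x _ => trunk x end.

                                                                          
                        
Definition incoming (n : nat) (A : {fset arrow n}) (i : 'I_n) : seq 'I_n :=
  [seq str (tl a) | a <- sort (fun a b => (pos (hd a) <= pos (hd b))%N)
                              [seq a <- A | str (hd a) == i]].

                                                                         
                            
Fixpoint branch (n : nat) (A : {fset arrow n}) (k : nat) (i : 'I_n) : rtree n :=
  if k is k'.+1 then
    foldl (fun x q => Vertex x (branch A k' q)) (Leaf i) (incoming A i)
  else Leaf i.

                                                                             
Definition tree_of (n : nat) (A : {fset arrow n}) (j : 'I_n) : rtree n :=
  branch A n j.

                                                                           
                                                                                
Fixpoint drawings (n : nat) (t : rtree n) : seq (seq 'I_n) :=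
  match t with
  | Leaf i => [:: [:: i]]
  | Vertex x y => [seq u ++ v | u <- drawings x, v <- drawings y] ++
                  [seq v ++ u | u <- drawings x, v <- drawings y]
  end.

                                                         
Definition planar (n : nat) (I : {set 'I_n}) (j : 'I_n) (t : rtree n) : bool :=
  enum (j |: I) \in drawings t.

Definition planar_tree_diagram (n : nat) (I : {set 'I_n}) (j : 'I_n)
    (A : {fset arrow n}) : bool :=
  tree_diagram I j A && planar I j (tree_of A j).

                                                    
Definition grid (n : nat) : {fset arrow n} :=
  [fset a | a in [seq (((p.1, val p.2), (q.1, val q.2)) : arrow n)
                 | p <- enum {: 'I_n * 'I_(2 * n)},
                   q <- enum {: 'I_n * 'I_(2 * n)}]].

                                                                         
                        
Definition planar_trees (n : nat) (I : {set 'I_n}) (j : 'I_n) :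
    {fset {fset arrow n}} :=
  [fset A in fpowerset (grid n) | planar_tree_diagram I j A].

Lemma size_endpoints (n : nat) (s : seq (arrow n)) :
  size (endpoints s) = (2 * size s)%N.
Proof.
by elim: s => //= a s IHs; rewrite /endpoints /= -/(endpoints s) IHs mulnS.
Qed.

Lemma mem_endpoints (n : nat) (s : seq (arrow n)) (a : arrow n) :
  a \in s -> (tl a \in endpoints s) * (hd a \in endpoints s).
Proof.
by move=> sa; split; apply/flattenP; exists [:: tl a; hd a];
  rewrite ?inE ?eqxx ?orbT //; apply/mapP; exists a.
Qed.

Lemma rank_lt (n : nat) (A : {fset arrow n}) (p : point n) :
  p \in endpoints A -> (pos (rank A p) < size (endpoints A))%N.
Proof.
move=> Ap; rewrite /rank /pos /= ltn_neqAle count_size andbT -all_count.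
by apply/allPn; exists p; rewrite //= ltnn andbF.
Qed.

Lemma card_tree_diagram (n : nat) (I : {set 'I_n}) (j : 'I_n)
    (A : {fset arrow n}) :
  tree_diagram I j A -> (size A <= n)%N.
Proof.
case/and3P=> _ _ /andP[/forallP tlA _].
have ut: uniq [seq str (tl a) | a <- A].
  apply/count_mem_uniq => i; rewrite count_map.
  have /eqP := tlA i; rewrite -has_pred1 has_map has_count.
  rewrite (eq_count (a2 := preim (fun a => str (tl a)) (pred1 i))) // => ->.
  by case: (i \in I).
rewrite -(size_map (fun a => str (tl a))) -[X in (_ <= X)%N](card_ord n).
by rewrite -(card_uniqP ut) max_card.
Qed.

Lemma in_planar_trees (n : nat) (I : {set 'I_n}) (j : 'I_n)
    (A : {fset arrow n}) :
  (A \in planar_trees I j) = planar_tree_diagram I j A.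
Proof.
rewrite !inE /=; apply: andb_idl => /andP[treeA _].
have leA := card_tree_diagram treeA; case/andP: treeA => /andP[_ /eqP nA] _.
rewrite fpowersetE; apply/fsubsetP => a; rewrite -{1}nA => /imfsetP[/= b Ab ->].
have bnd p: p \in endpoints A -> (pos (rank A p) < 2 * n)%N.
  move=> /rank_lt ltp; apply: leq_trans ltp _.
  by rewrite size_endpoints leq_mul2l.
have [tb hb] := mem_endpoints Ab; have tb' := bnd _ tb; have hb' := bnd _ hb.
rewrite in_fset; apply/allpairsP.
exists ((str (tl b), Ordinal tb'), (str (hd b), Ordinal hb')).
by rewrite !mem_enum.
Qed.

Definition all_planar_trees (n : nat) (j : 'I_n) : {fset {fset arrow n}} :=
  \bigcup_(I <- enum {: {set 'I_n}} | j \notin I) planar_trees I j.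

                                                   

                                                      
Inductive monomial (n : nat) : Type :=
  | Var of 'I_n
  | Dashv of monomial n & monomial n
  | Vdash of monomial n & monomial n.

Fixpoint encode_monomial (n : nat) (m : monomial n) : GenTree.tree 'I_n :=
  match m with
  | Var i => GenTree.Leaf i
  | Dashv x y => GenTree.Node 0 [:: encode_monomial x; encode_monomial y]
  | Vdash x y => GenTree.Node 1 [:: encode_monomial x; encode_monomial y]
  end.

Fixpoint decode_monomial (n : nat) (t : GenTree.tree 'I_n) :
    option (monomial n) :=
  match t with
  | GenTree.Leaf i => Some (Var i)
  | GenTree.Node 0 [:: x; y] =>
      if (decode_monomial x, decode_monomial y) is (Some u, Some v)
      then Some (Dashv u v) else None
  | GenTree.Node 1 [:: x; y] =>
      if (decode_monomial x, decode_monomial y) is (Some u, Some v)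
      then Some (Vdash u v) else None
  | _ => None
  end.

Lemma encode_monomialK (n : nat) :
  pcancel (@encode_monomial n) (@decode_monomial n).
Proof. by elim=> //= x -> y ->. Qed.

HB.instance Definition _ (n : nat) :=
  Choice.copy (monomial n) (pcan_type (@encode_monomialK n)).

Fixpoint vars (n : nat) (m : monomial n) : seq 'I_n :=
  match m with
  | Var i => [:: i]
  | Dashv x y | Vdash x y => vars x ++ vars y
  end.

Fixpoint monomial_of (n : nat) (t : rtree n) : monomial n :=
  match t with
  | Leaf i => Var i
  | Vertex x y =>
      if (trunk x < trunk y)%N then Dashv (monomial_of x) (monomial_of y)
      else Vdash (monomial_of y) (monomial_of x)
  end.

Lemma trunk_drawings (n : nat) (t : rtree n) (w : seq 'I_n) :
  w \in drawings t -> trunk t \in w.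
Proof.
elim: t w => [i|x IHx y _] w /=; first by rewrite inE => /eqP->; rewrite inE.
by rewrite mem_cat => /orP[] /allpairsP[[u v] /= [/IHx xu _ ->]];
  rewrite mem_cat xu ?orbT.
Qed.

                                                                          
Lemma vars_monomial_of (n : nat) (t : rtree n) (w : seq 'I_n) :
  w \in drawings t -> sorted (fun i k : 'I_n => (i < k)%N) w ->
  vars (monomial_of t) = w.
Proof.
have tr: transitive (fun i k : 'I_n => (i < k)%N).
  by move=> a b c; apply: ltn_trans.
elim: t w => [i|x IHx y IHy] w /=; first by rewrite inE => /eqP->.
rewrite mem_cat => /orP[] /allpairsP[[u v] /= [xu yv ->]];
  rewrite (sorted_pairwise tr) pairwise_cat -!(sorted_pairwise tr);
  case/and3P=> /allrelP lt_uv su sv.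
- rewrite lt_uv ?(trunk_drawings xu) ?(trunk_drawings yv) //=.
  by rewrite (IHx u) ?(IHy v).
- rewrite ltnNge ltnW ?lt_uv ?(trunk_drawings xu) ?(trunk_drawings yv) //=.
  by rewrite (IHx u) ?(IHy v).
Qed.

                                                      
Definition planar_monomial (n : nat) : Type :=
  {m : monomial n | sorted (fun i k : 'I_n => (i < k)%N) (vars m)}.
HB.instance Definition _ (n : nat) := SubChoice.on (planar_monomial n).

Inductive dias_step (n : nat) : monomial n -> monomial n -> Prop :=
  | Dias1 x y z : dias_step (Dashv (Dashv x y) z) (Dashv x (Vdash y z))
  | Dias2 x y z : dias_step (Dashv (Dashv x y) z) (Dashv x (Dashv y z))
  | Dias3 x y z : dias_step (Dashv (Vdash x y) z) (Vdash x (Dashv y z))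
  | Dias4 x y z : dias_step (Vdash (Dashv x y) z) (Vdash x (Vdash y z))
  | Dias5 x y z : dias_step (Vdash (Vdash x y) z) (Vdash x (Vdash y z))
  | DashvL x x' y : dias_step x x' -> dias_step (Dashv x y) (Dashv x' y)
  | DashvR x y y' : dias_step y y' -> dias_step (Dashv x y) (Dashv x y')
  | VdashL x x' y : dias_step x x' -> dias_step (Vdash x y) (Vdash x' y)
  | VdashR x y y' : dias_step y y' -> dias_step (Vdash x y) (Vdash x y').

                                              
Inductive dias_null (n : nat) : {freeg (planar_monomial n) / int} -> Prop :=
  | DiasNull0 : dias_null 0
  | DiasNullB u v : dias_null u -> dias_null v -> dias_null (u - v)
  | DiasNullG (m m' : planar_monomial n) :
      dias_step (val m) (val m') -> dias_null (<< m >> - << m' >>).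

Definition dias_eq (n : nat) (u v : {freeg (planar_monomial n) / int}) : bool :=
  `[< dias_null (u - v) >].

Lemma dias_nullN (n : nat) (u : {freeg (planar_monomial n) / int}) :
  dias_null u -> dias_null (- u).
Proof. by move=> nu; rewrite -sub0r; apply: DiasNullB nu; apply: DiasNull0. Qed.

Lemma dias_nullD (n : nat) (u v : {freeg (planar_monomial n) / int}) :
  dias_null u -> dias_null v -> dias_null (u + v).
Proof.
by move=> nu nv; rewrite -[v]opprK; apply: DiasNullB nu (dias_nullN nv).
Qed.

Lemma dias_eq_refl (n : nat) : reflexive (@dias_eq n).
Proof. by move=> u; apply/asboolP; rewrite subrr; apply: DiasNull0. Qed.

Lemma dias_eq_sym (n : nat) : symmetric (@dias_eq n).
Proof.
by move=> u v; apply/asboolP/asboolP => /dias_nullN; rewrite opprB.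
Qed.

Lemma dias_eq_trans (n : nat) : transitive (@dias_eq n).
Proof.
move=> v u w /asboolP uv /asboolP vw; apply/asboolP.
by rewrite -(subrKA v); apply: dias_nullD.
Qed.

Canonical dias_equiv (n : nat) :=
  EquivRel (@dias_eq n) (@dias_eq_refl n) (@dias_eq_sym n) (@dias_eq_trans n).
Canonical dias_equiv_direct (n : nat) := defaultEncModRel (@dias_eq n).

Local Open Scope quotient_scope.

                                                                           
                                                                   
                 
Definition Dias (n : nat) : Type := {eq_quot (@dias_eq n)}.
HB.instance Definition _ (n : nat) := Choice.on (Dias n).
HB.instance Definition _ (n : nat) := EqQuotient.on (Dias n).

Definition dias_zero (n : nat) : Dias n := \pi_(Dias n) 0.
Definition dias_opp (n : nat) (x : Dias n) : Dias n := \pi_(Dias n) (- repr x).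
Definition dias_add (n : nat) (x y : Dias n) : Dias n :=
  \pi_(Dias n) (repr x + repr y).

Lemma repr_pi_dias (n : nat) (u : {freeg (planar_monomial n) / int}) :
  dias_null (repr (\pi_(Dias n) u) - u).
Proof.
suff /eqmodP/asboolP : repr (\pi_(Dias n) u) = u %[mod Dias n] by [].
by rewrite reprK.
Qed.

Lemma pi_dias_opp (n : nat) (u : {freeg (planar_monomial n) / int}) :
  \pi_(Dias n) (- u) = dias_opp (\pi_(Dias n) u).
Proof.
apply/esym/eqmodP/asboolP; rewrite -opprD; apply: dias_nullN.
exact: repr_pi_dias.
Qed.

Lemma pi_dias_add (n : nat) (u v : {freeg (planar_monomial n) / int}) :
  \pi_(Dias n) (u + v) = dias_add (\pi_(Dias n) u) (\pi_(Dias n) v).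
Proof.
apply/esym/eqmodP/asboolP; rewrite opprD addrACA.
by apply: dias_nullD; apply: repr_pi_dias.
Qed.

Lemma dias_addA (n : nat) : associative (@dias_add n).
Proof.
move=> x y z; rewrite -[x]reprK -[y]reprK -[z]reprK.
set u := repr x; set v := repr y; set w := repr z.
by rewrite -(pi_dias_add v w) -(pi_dias_add u v) -!pi_dias_add addrA.
Qed.

Lemma dias_addC (n : nat) : commutative (@dias_add n).
Proof. by move=> x y; rewrite /dias_add addrC. Qed.

Lemma dias_add0 (n : nat) : left_id (dias_zero n) (@dias_add n).
Proof.
by move=> x; rewrite -[x]reprK -(pi_dias_add 0 (repr x)) add0r.
Qed.

Lemma dias_addN (n : nat) :
  left_inverse (dias_zero n) (@dias_opp n) (@dias_add n).
Proof.
move=> x; rewrite -[x]reprK -(pi_dias_opp (repr x)).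
by rewrite -(pi_dias_add (- repr x) (repr x)) addNr.
Qed.

HB.instance Definition _ (n : nat) :=
  GRing.isZmodule.Build (Dias n)
    (@dias_addA n) (@dias_addC n) (@dias_add0 n) (@dias_addN n).

HB.instance Definition _ (n : nat) :=
  @isZmodQuotient.Build {freeg (planar_monomial n) / int} (@dias_eq n)
    0 -%R +%R (Dias n) erefl (@pi_dias_opp n) (@pi_dias_add n).

                                                                            
                               
                          
Definition dias_class (n : nat) (m : monomial n) : Dias n :=
  if insub m is Some m' then
    \pi_(Dias n)
      (<< (m' : planar_monomial n) >> : {freeg (planar_monomial n) / int})
  else 0.

Definition Z (n : nat) (j : 'I_n) (G : gauss n) : Dias n :=
  \sum_(A <- all_planar_trees j)
    dias_class (monomial_of (tree_of A j)) *~ (sign_diagram A * pairing A G).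

(* Main.v *)
(* Expanding the pairings turns Z j G into a sum, over the sets T of arrows of G, of the
   class of the tree drawn by T.  This class depends on T only up to string-preserving maps
   that are monotone on its endpoints.  A tree has no arrow from a string to itself and at
   most one tail on each string, so the first move adds only zero terms and the second adds
   terms that cancel in pairs.  Under the third move the sets containing at most one of the
   three arrows correspond, and the others are no trees unless they contain, besides a common
   rest, exactly
     t -> m -> b,   or t -> b below m -> b   (before),   or m -> b below t -> b   (after).
   If x, y, z are the subtrees on b, m, t, the three trees have subtrees x(yz), (xz)y, (xy)z
   at one place and agree elsewhere.  For each order of b, m, t one of them is not planar,
   and equality of the signed sums is one of the five diassociative relations. *)

(* The third move is asymmetric because of string m. Before the move the head of t -> m lies just
   before the tail of m -> b, as a tree requires; afterwards it lies just behind that tail. The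
   pairs containing both t -> m and t -> b have two tails on t. In each surviving pair only one
   endpoint on t is used, so it can slide across the gap; this brings all three pairs to the same
   two tails, and only the heads differ. The obstacle is the encoding: diagrams are compared through
   normal forms, and trees are computed with fuel from sorted lists of heads. Hence [weight] takes
   any finite set of arrows, is 0 off trees, and is shown constant under order-preserving
   relabelling. Passing to ranks, isomorphisms of Gauss diagrams and sliding an endpoint are three
   instances of this. Trees are then handled by a fuel-free equation, whose inductions rest on
   acyclicity, derived from the fact that every string of [I] leads to the trunk. Invariance holds
   for each leaf set [I] separately, so [I] is fixed almost everywhere. *)
Require Import Defs.
From mathcomp Require Import all_boot all_order all_algebra zify.
From mathcomp Require Import finmap boolp.

Set Implicit Arguments.
Unset Strict Implicit.
Unset Printing Implicit Defensive.

Import GRing.Theory.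

Local Open Scope fset_scope.
Local Open Scope ring_scope.
Local Open Scope quotient_scope.

(** * Planar trees and the diassociative relations *)

Section Diassociative.
Variable n : nat.
Implicit Types (x y z : monomial n) (t u v : rtree n) (w : seq 'I_n).

Local Notation increasing := (sorted (fun i k : 'I_n => (i < k)%N)).

Lemma increasing_trans : transitive (fun i k : 'I_n => (i < k)%N).
Proof. by move=> a b c; apply: ltn_trans. Qed.

Lemma dias_step_vars x y : dias_step x y -> vars x = vars y.
Proof. by elim=> //= *; rewrite -?catA //; congr cat. Qed.

(** A step keeps the word of variables, so both sides are planar monomials or both receive the
    default value 0. *)
Lemma dias_class_step x y : dias_step x y -> dias_class x = dias_class y.
Proof.
move=> xy; rewrite /dias_class; have eqv := dias_step_vars xy.
case: insubP => [x' sx x'E|nsx]; case: insubP => [y' sy y'E|nsy] //.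
- apply/eqmodP/asboolP; apply: DiasNullG.
  by rewrite x'E y'E.
- by move: nsy; rewrite -eqv sx.
- by move: nsx; rewrite eqv sy.
Qed.

Lemma vars_drawings t : vars (monomial_of t) \in drawings t.
Proof.
elim: t => [i|x IHx y IHy] /=; first by rewrite inE.
rewrite mem_cat; case: ifP => _ /=; apply/orP; [left|right];
by apply/allpairsP; exists (vars (monomial_of x), vars (monomial_of y)).
Qed.

Lemma enum_increasing (A : {set 'I_n}) : increasing (enum A).
Proof.
rewrite /enum_mem; apply: sorted_filter; first exact: increasing_trans.
by rewrite -enumT -(@sorted_map _ _ (@nat_of_ord n) ltn) val_enum_ord iota_ltn_sorted.
Qed.

(** In an increasing drawing the order of the two trunks decides the side at every vertex, so the
    only candidate is the word read off by [monomial_of]. No search through [drawings] remains. *)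
Lemma planarE (I : {set 'I_n}) (j : 'I_n) t :
  planar I j t = (vars (monomial_of t) == enum (j |: I)).
Proof.
apply/idP/eqP => [pl|E]; last by rewrite /planar -E vars_drawings.
exact: vars_monomial_of pl (enum_increasing _).
Qed.

(** A tree with one hole. It isolates the place, possibly deep in the tree, where the third move
    acts. *)
Inductive tree_context : Type :=
  | Hole
  | OnTrunk of tree_context & rtree n
  | OnBranch of rtree n & tree_context.

Fixpoint plug (C : tree_context) (t : rtree n) : rtree n :=
  match C with
  | Hole => t
  | OnTrunk C y => Vertex (plug C t) y
  | OnBranch x C => Vertex x (plug C t)
  end.

(** The word [w] will be [enum (j |: I)]. The value 0 on nonplanar trees lets them stay in the
    sums. *)
Definition planar_class w t : Dias n :=
  if vars (monomial_of t) == w then dias_class (monomial_of t) else 0.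

Lemma trunk_plug C t u : trunk t = trunk u -> trunk (plug C t) = trunk (plug C u).
Proof. by elim: C => //= C IHC y /IHC. Qed.

(** [monomial_of] selects the operation at a vertex by comparing trunks; equal trunks keep all
    operations on the way to the hole the same. *)
Lemma dias_step_plug C t u : trunk t = trunk u ->
  dias_step (monomial_of t) (monomial_of u) ->
  dias_step (monomial_of (plug C t)) (monomial_of (plug C u)).
Proof.
move=> tu stu; elim: C => //= [C IHC y|x C IHC]; rewrite (trunk_plug C tu);
  by case: ifP => _; constructor.
Qed.

Lemma planar_class_step w C t u : trunk t = trunk u ->
  dias_step (monomial_of t) (monomial_of u) ->
  planar_class w (plug C t) = planar_class w (plug C u).
Proof.
move=> tu /(dias_step_plug C tu) stu.
by rewrite /planar_class (dias_step_vars stu) (dias_class_step stu).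
Qed.

Lemma increasing_plug C t : increasing (vars (monomial_of (plug C t))) ->
  increasing (vars (monomial_of t)).
Proof.
by elim: C => //= [C IHC y|x C IHC]; case: ifP => _ /cat_sorted2[]; auto.
Qed.

(* The leaves of a subtree are consecutive in the monomial, so an inversion inside the
   subtree survives in the whole word. *)
Lemma planar_class_unsorted w C t : increasing w ->
  ~~ increasing (vars (monomial_of t)) -> planar_class w (plug C t) = 0.
Proof.
rewrite /planar_class => sw; case: eqP => [wE|//] /negP[].
by apply: (@increasing_plug C); rewrite wE.
Qed.

Lemma trunk_vars t : trunk t \in vars (monomial_of t).
Proof. exact: trunk_drawings (vars_drawings t). Qed.

Lemma increasing_cat x y : increasing (vars x ++ vars y) ->
  forall i k, i \in vars x -> k \in vars y -> (i < k)%N.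
Proof.
rewrite (sorted_pairwise increasing_trans) pairwise_cat => /andP[/allrelP h _].
exact: h.
Qed.

(** The factor of [sign_diagram] due to one arrow from string [i] to string [k]. *)
Definition right_sign (i k : 'I_n) : int := (-1) ^+ (i < k)%N.

(** If the trunks of [m] and [t] lie on opposite sides of that of [x], the first tree is not planar.
    If they lie on the same side, the one nearer to [x] must be attached first, which kills one of
    the other two trees. The surviving equation is relation (2) for x < m < t, (1) for x < t < m,
    (3) for t < x < m and for m < x < t, (4) for m < t < x, and (5) for t < m < x. *)
Lemma omega3_trees w C (x m t : rtree n) : increasing w ->
  uniq [:: trunk x; trunk m; trunk t] ->
  planar_class w (plug C (Vertex x (Vertex m t))) *~
     (right_sign (trunk t) (trunk m) * right_sign (trunk m) (trunk x)) +
  planar_class w (plug C (Vertex (Vertex x t) m)) *~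
     (right_sign (trunk t) (trunk x) * right_sign (trunk m) (trunk x)) =
  planar_class w (plug C (Vertex (Vertex x m) t)) *~
     (right_sign (trunk t) (trunk x) * right_sign (trunk m) (trunk x)).
Proof.
move=> sw; rewrite /= !inE negb_or andbT => /andP[/andP[xm xt] mt].
have tx := trunk_vars x; have tm := trunk_vars m; have tt := trunk_vars t.
have step u v := @planar_class_step w C u v.
have unsorted u p q y z : vars (monomial_of u) = vars y ++ vars z ->
    p \in vars y -> q \in vars z -> (q < p)%N -> planar_class w (plug C u) = 0.
  move=> uE py qz qp; apply: planar_class_unsorted => //; rewrite uE.
  by apply: contraL qp => /increasing_cat/(_ _ _ py qz); rewrite -leqNgt => /ltnW.
(* Each alternative carries the truth value of both comparisons, because signs and [monomial_of]
   test them in different directions. *)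
have lt_or (i k : 'I_n) : i != k ->
    ((i < k)%N * ((k < i)%N = false)) + (((i < k)%N = false) * (k < i)%N).
  by case: (ltngtP i k) => [|| /val_inj ->] // ; [left|right|rewrite eqxx].
(* Of the eight patterns, the third and the sixth are cyclic and contradictory. *)
rewrite /right_sign; case: (lt_or _ _ xm) => {}xm; case: (lt_or _ _ xt) => {}xt;
  case: (lt_or _ _ mt) => {}mt.
all: rewrite ?xm ?xt ?mt /= ?expr0 ?expr1 ?mulr1 ?mul1r ?mulrNN ?mulr1z ?mulrNz.
- rewrite (unsorted (Vertex (Vertex x t) m) (trunk t) (trunk m)
    (Dashv (monomial_of x) (monomial_of t)) (monomial_of m)) /=;
    rewrite ?xm ?xt ?mt ?mem_cat ?tx ?tm ?tt ?orbT ?mul0rz ?addr0 //.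
  by apply/esym/step; rewrite //= xm /= xt mt; constructor.
- rewrite (unsorted (Vertex (Vertex x m) t) (trunk m) (trunk t)
    (Dashv (monomial_of x) (monomial_of m)) (monomial_of t)) /=;
    rewrite ?xm ?xt ?mt ?mem_cat ?tx ?tm ?tt ?orbT ?mul0rz //.
  apply/eqP; rewrite addrC subr_eq0; apply/eqP/step; rewrite //= xm /= xt mt.
  by constructor.
- by have := ltn_trans xm.1 (ltn_trans mt.1 xt.2); rewrite ltnn.
- rewrite (unsorted (Vertex x (Vertex m t)) (trunk x) (trunk t)
    (monomial_of x) (Vdash (monomial_of t) (monomial_of m))) /=;
    rewrite ?xm ?xt ?mt ?mem_cat ?tx ?tm ?tt ?orbT ?mul0rz ?oppr0 ?add0r //.
  by congr (- _); apply: step; rewrite //= xm /= xt; constructor.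
- rewrite (unsorted (Vertex x (Vertex m t)) (trunk t) (trunk x)
    (Dashv (monomial_of m) (monomial_of t)) (monomial_of x)) /=;
    rewrite ?xm ?xt ?mt ?mem_cat ?tx ?tm ?tt ?orbT ?mul0rz ?oppr0 ?add0r //.
  by congr (- _); apply/esym/step; rewrite //= xm /= xt; constructor.
- by have := ltn_trans xm.2 (ltn_trans xt.1 mt.2); rewrite ltnn.
- rewrite (unsorted (Vertex (Vertex x m) t) (trunk t) (trunk m)
    (monomial_of t) (Vdash (monomial_of m) (monomial_of x))) /=;
    rewrite ?xm ?xt ?mt ?mem_cat ?tx ?tm ?tt ?orbT ?mul0rz //.
  apply/eqP; rewrite addrC subr_eq0; apply/eqP/esym/step; rewrite //= xm /= xt mt.
  by constructor.
- rewrite (unsorted (Vertex (Vertex x t) m) (trunk m) (trunk t)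
    (monomial_of m) (Vdash (monomial_of t) (monomial_of x))) /=;
    rewrite ?xm ?xt ?mt ?mem_cat ?tx ?tm ?tt ?orbT ?mul0rz ?addr0 //.
  by apply: step; rewrite //= xm /= xt mt; constructor.
Qed.

End Diassociative.

(** * Rooted forests as functional graphs *)

Section FunctionalGraph.
Variables (T : finType) (e : rel T) (r : T).
Hypotheses (functional : forall x y z, e x y -> e x z -> y = z)
  (root_sink : forall x, ~~ e r x)
  (rooted : forall x y, e x y -> connect e x r).

Lemma connect_head x y : connect e x y -> x = y \/ exists2 z, e x z & connect e z y.
Proof.
case/connectP => -[|z p] /= => [_ ->|/andP[xz zp] ->]; [by left|right].
by exists z => //; apply/connectP; exists p.
Qed.

(** With at most one edge out of each vertex, there is a single forward path from [x], and [y] and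
    [z] both lie on it. *)
Lemma connect_total x y z :
  connect e x y -> connect e x z -> connect e y z \/ connect e z y.
Proof.
case/connectP=> p; elim: p x => [|x' p IHp] x /=.
  by move=> _ -> ?; left.
case/andP=> xx' xp yE xz; case: (connect_head xz) => [<-|[u xu uz]].
  by right; apply/connectP; exists (x' :: p); rewrite //= xx'.
by apply: (IHp x') => //; rewrite (functional xx' xu).
Qed.

(** If [y] led back to [x], the unique forward path from [x] would stay on that cycle. This path
    ends at [r], so [r] would have an outgoing edge. *)
Lemma connect_acyclic x y : e x y -> ~~ connect e y x.
Proof.
move=> xy; apply/negP => yx.
have [p rp] := connectP (rooted xy) => rE.
suff: connect e r x.
  case/connect_head=> [rx|[z rz]]; last by rewrite (negPf (root_sink z)) in rz.
  by move: xy; rewrite -rx (negPf (root_sink y)).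
(* Every vertex of the path from [x] still leads back to [x]; the induction extends the path at its
   end. *)
rewrite rE {rE}; elim/last_ind: p rp => [|p z IHp] /=; first by rewrite connect0.
rewrite rcons_path last_rcons => /andP[/IHp lx lz].
case: (connect_head lx) => [lE|[u lu ux]]; last by rewrite (functional lz lu).
by rewrite lE in lz; rewrite (functional lz xy).
Qed.

(** Of two such children one would lead to the other; its only edge goes to [y], which closes a
    cycle. Hence a given subtree lies in only one branch at each vertex. *)
Lemma child_unique x y q q' :
  e q y -> e q' y -> connect e x q -> connect e x q' -> q = q'.
Proof.
move=> qy q'y xq xq'; case: (connect_total xq xq') => /connect_head[//|[u]].
- by move=> qu; rewrite -(functional qy qu) (negPf (connect_acyclic q'y)).
- by move=> qu; rewrite -(functional q'y qu) (negPf (connect_acyclic qy)).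
Qed.

(* Counts the descendants of [x]: as fuel, this many steps of [branch] suffice at [x]. *)
Definition height x := #|[set y | connect e y x]|.

Lemma height_child x y : e x y -> (height x < height y)%N.
Proof.
move=> xy; apply: proper_card; apply/properP; split.
  apply/subsetP => z; rewrite !inE => zx; exact: connect_trans zx (connect1 xy).
by exists y; rewrite inE ?connect0 ?connect_acyclic.
Qed.

Lemma height_gt0 x : (0 < height x)%N.
Proof. by apply/card_gt0P; exists x; rewrite inE. Qed.

Lemma height_le x : (height x <= #|T|)%N.
Proof. exact: max_card. Qed.

End FunctionalGraph.

(** * Relabelling the endpoints of an arrow diagram *)

Section Arrows.
Variable n : nat.
Implicit Types (a b : arrow n) (p q : point n) (s : seq (arrow n))
  (A B : {fset arrow n}) (I : {set 'I_n}) (i j : 'I_n).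

Lemma endpoints_cons a s : endpoints (a :: s) = [:: tl a, hd a & endpoints s].
Proof. by []. Qed.

Lemma perm_endpoints s1 s2 : perm_eq s1 s2 -> perm_eq (endpoints s1) (endpoints s2).
Proof. by move=> s12; apply: perm_flatten; apply: perm_map. Qed.

Lemma endpoints_map (f : point n -> point n) s :
  endpoints [seq (f (tl a), f (hd a)) | a <- s] = map f (endpoints s).
Proof. by elim: s => // a s IHs; rewrite map_cons !endpoints_cons /= IHs. Qed.

Lemma perm_fset1U (K : choiceType) (x : K) (T : {fset K}) :
  x \notin T -> perm_eq (x |` T) (x :: T).
Proof.
by move=> Tx; apply: uniq_perm; rewrite /= ?Tx ?fset_uniq // => y; rewrite !inE.
Qed.

Lemma endpoints_fset1U a A : a \notin A ->
  perm_eq (endpoints (a |` A)) [:: tl a, hd a & endpoints A].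
Proof.
by move=> Aa; rewrite -endpoints_cons; apply/perm_endpoints/perm_fset1U.
Qed.

Lemma hd_inj s : uniq (endpoints s) -> {in s &, injective (@hd n)}.
Proof.
elim: s => // a s IHs; rewrite endpoints_cons /= => /and3P[_ na us] x y.
rewrite !inE => /predU1P[->|sx] /predU1P[->|sy] // xy; last exact: IHs.
- by move: na; rewrite xy (mem_endpoints sy).
- by move: na; rewrite -xy (mem_endpoints sx).
Qed.

Lemma sub_count_lt (T : eqType) (P Q : pred T) (r : seq T) x :
  subpred P Q -> x \in r -> Q x -> ~~ P x -> (count P r < count Q r)%N.
Proof.
move=> sPQ + Qx nPx; elim: r => //= y r IHr; rewrite inE => /predU1P[<-|/IHr lt].
  by rewrite Qx (negPf nPx) add0n add1n ltnS sub_count.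
by rewrite -addnS leq_add //; case Py: (P y); rewrite ?(sPQ _ Py).
Qed.

Lemma uniq_map_inj (T T' : eqType) (f : T -> T') (r : seq T) :
  uniq (map f r) -> {in r &, injective f}.
Proof.
elim: r => //= x r IHr /andP[nx ur] y z; rewrite !inE.
move=> /predU1P[->|ry] /predU1P[->|rz] // fyz; last exact: IHr.
- by rewrite fyz map_f in nx.
- by rewrite -fyz map_f in nx.
Qed.

Definition before_head a b := (pos (hd a) < pos (hd b))%N.

(** Distinct positions leave only one sorted order. Exhibiting a strictly sorted permutation thus
    replaces every computation with [sort]. *)
Lemma incoming_unique A i s : perm_eq s [seq a <- A | str (hd a) == i] ->
  sorted before_head s -> incoming A i = [seq str (tl a) | a <- s].
Proof.
move=> ps ss; rewrite /incoming; congr map.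
set le := fun a b => _; set F := [seq _ <- _ | _] in ps *.
apply: (@sorted_eq_in _ le) => [|x y Fx Fy||| ].
- by apply: in3W => x y z; apply: leq_trans.
- rewrite /le -eqn_leq => /eqP xy.
  have := ss; rewrite -(@sorted_map _ _ (fun a => pos (hd a)) ltn).
  rewrite ltn_sorted_uniq_leq => /andP[us _].
  rewrite !mem_sort -!(perm_mem ps) in Fx Fy.
  exact: uniq_map_inj us _ _ Fx Fy xy.
- by apply: sort_sorted => x y; apply: leq_total.
- by apply: sub_sorted ss => x y; apply: ltnW.
- by rewrite perm_sort perm_sym.
Qed.

Lemma sort_heads A i : uniq (endpoints A) ->
  sorted before_head (sort (fun a b => (pos (hd a) <= pos (hd b))%N)
                              [seq a <- A | str (hd a) == i]).
Proof.
move=> uA; rewrite -(@sorted_map _ _ (fun a => pos (hd a)) ltn) ltn_sorted_uniq_leq.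
rewrite sorted_map sort_sorted ?andbT => [|x y]; last exact: leq_total.
rewrite map_inj_in_uniq ?sort_uniq ?filter_uniq ?fset_uniq // => a b.
rewrite !mem_sort !mem_filter => /andP[/eqP ai Aa] /andP[/eqP bi Ab] ab.
apply: (hd_inj uA) => //.
by case: (hd a) (hd b) ai bi ab => [? ?] [? ?] /= -> -> ->.
Qed.

Definition relabel (f : point n -> point n) A := [fset (f (tl a), f (hd a)) | a in A].

Definition monotone_on (E : seq (point n)) (f : point n -> point n) :=
  (forall p, str (f p) = str p) /\
  {in E &, forall p q, str p = str q -> (pos p < pos q)%N -> (pos (f p) < pos (f q))%N}.

(** The implication becomes an equivalence by trichotomy, since a point is determined by its string
    and its position. *)
Lemma monotone_on_ltn E f : monotone_on E f ->
  {in E &, forall p q, str p = str q -> (pos (f p) < pos (f q))%N = (pos p < pos q)%N}.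
Proof.
move=> [_ mf] p q Ep Eq pq; case: (ltngtP (pos p) (pos q)) => [lt|gt|eq].
- exact: mf.
- by apply/negbTE; rewrite -leqNgt ltnW ?mf.
- suff -> : p = q by rewrite ltnn.
  by case: p q pq eq {Ep Eq} => [? ?] [? ?] /= -> ->.
Qed.

Lemma monotone_on_inj E f : monotone_on E f -> {in E &, injective f}.
Proof.
move=> mf p q Ep Eq fpq; have pq : str p = str q by rewrite -(mf.1 p) -(mf.1 q) fpq.
case: (ltngtP (pos p) (pos q)) => [||e].
- by rewrite -(monotone_on_ltn mf) // fpq ltnn.
- by rewrite -(monotone_on_ltn mf) // fpq ltnn.
- by case: p q pq e {Ep Eq fpq} => [? ?] [? ?] /= -> ->.
Qed.

(* [tree_diagram] without normality of positions: [A] can be any set of arrows of a Gauss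
   diagram. *)
Definition tree_shape I j A : bool :=
  [&& all (fun a => str (tl a) != str (hd a)) A,
      [forall i, count (fun a => str (tl a) == i) A == (i \in I)],
      all (fun a => str (hd a) \in j |: I) A,
      all (fun a => all (fun b => (str (hd b) == str (tl a)) ==>
                                  (pos (hd b) < pos (tl a))%N) A) A
    & [forall i in I, connect (arrow_rel A) i j]].

(** The contribution of a set of arrows before the signs of the Gauss arrows enter. No normal form
    is taken; invariance under relabelling takes its place. *)
Definition weight I j A : Dias n :=
  if tree_shape I j A
  then planar_class (enum (j |: I)) (tree_of A j) *~ sign_diagram A else 0.

(** * Order-preserving relabelling *)

Section Relabel.
Variables (f : point n -> point n) (A : {fset arrow n}).
Hypotheses (uA : uniq (endpoints A)) (mf : monotone_on (endpoints A) f).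

Lemma relabel_arrow_inj : {in A &, injective (fun a => (f (tl a), f (hd a)))}.
Proof.
move=> a b Aa Ab [tab hab].
have [ta ha] := mem_endpoints Aa; have [tb hb] := mem_endpoints Ab.
have := monotone_on_inj mf ta tb tab; have := monotone_on_inj mf ha hb hab.
by case: a b {Aa Ab tab hab ta ha tb hb} => ? ? [? ?] /= -> ->.
Qed.

Lemma perm_relabel : perm_eq (relabel f A) [seq (f (tl a), f (hd a)) | a <- A].
Proof. by apply: enum_imfset => a b; apply: relabel_arrow_inj. Qed.

Lemma perm_endpoints_relabel : perm_eq (endpoints (relabel f A)) (map f (endpoints A)).
Proof. by rewrite -endpoints_map; apply/perm_endpoints/perm_relabel. Qed.

Lemma uniq_endpoints_relabel : uniq (endpoints (relabel f A)).
Proof.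
rewrite (perm_uniq perm_endpoints_relabel) map_inj_in_uniq //.
exact: monotone_on_inj mf.
Qed.

Lemma str_f p : str (f p) = str p. Proof. exact: mf.1. Qed.

Lemma arrow_rel_relabel : arrow_rel (relabel f A) =2 arrow_rel A.
Proof.
move=> p q; rewrite /arrow_rel (perm_has _ perm_relabel) has_map.
by apply: eq_has => a; rewrite /= /tl /hd /= !str_f.
Qed.

Lemma tree_shape_relabel I j : tree_shape I j (relabel f A) = tree_shape I j A.
Proof.
rewrite /tree_shape; congr [&& _, _, _, _ & _].
- rewrite (perm_all _ perm_relabel) all_map.
  by apply: eq_all => a; rewrite /= !str_f.
- apply: eq_forallb => i; rewrite (permP perm_relabel) count_map.
  by congr (_ == _); apply: eq_count => a; rewrite /= str_f.
- rewrite (perm_all _ perm_relabel) all_map.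
  by apply: eq_all => a; rewrite /= !str_f.
- rewrite (perm_all _ perm_relabel) all_map; apply: eq_in_all => a Aa /=.
  rewrite (perm_all _ perm_relabel) all_map; apply: eq_in_all => b Ab /=.
  rewrite !str_f; case: eqP => //= ab.
  by apply: monotone_on_ltn mf _ _ _ _ ab; rewrite (mem_endpoints Aa, mem_endpoints Ab).
- by apply: eq_forallb => i; rewrite (eq_connect arrow_rel_relabel).
Qed.

(** The image of the sorted list of heads is again strictly sorted, so [incoming_unique] applies.
    The whole tree follows, since [branch] sees the arrows only through [incoming]. *)
Lemma incoming_relabel i : incoming (relabel f A) i = incoming A i.
Proof.
rewrite {2}/incoming; set s := sort _ _.
have sA : {subset s <= A} by move=> a; rewrite mem_sort mem_filter => /andP[].
have si a : a \in s -> str (hd a) = i.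
  by rewrite mem_sort mem_filter => /andP[/eqP].
rewrite (@incoming_unique _ _ [seq (f (tl a), f (hd a)) | a <- s]).
- by rewrite -map_comp; apply: eq_map => a; rewrite /= str_f.
- rewrite (perm_trans (perm_map _ (permEl (perm_sort _ _)))) // perm_sym.
  rewrite (perm_trans (perm_filter _ perm_relabel)) // filter_map.
  rewrite (eq_filter (a2 := fun a => str (hd a) == i)) ?perm_refl // => a.
  by rewrite /= str_f.
- rewrite sorted_map -(@eq_in_sorted _ (mem s) before_head) ?sort_heads //.
    move=> a b sa sb; rewrite /before_head /= (monotone_on_ltn mf) //.
    + by rewrite (mem_endpoints (sA _ sa)).
    + by rewrite (mem_endpoints (sA _ sb)).
    + by rewrite !si.
Qed.

Lemma eq_branch A1 A2 : incoming A1 =1 incoming A2 -> branch A1 =2 branch A2.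
Proof.
move=> e12; elim=> //= k IHk i; rewrite e12.
by elim: (incoming A2 i) (Leaf i) => //= q s IHs x; rewrite IHk IHs.
Qed.

Lemma sign_diagram_relabel : sign_diagram (relabel f A) = sign_diagram A.
Proof.
rewrite /sign_diagram (permP perm_relabel) count_map; congr (_ ^+ _).
by apply: eq_count => a; rewrite /= !str_f.
Qed.

Lemma tree_of_relabel j : tree_of (relabel f A) j = tree_of A j.
Proof. exact: eq_branch incoming_relabel n j. Qed.

Lemma weight_relabel I j : weight I j (relabel f A) = weight I j A.
Proof. by rewrite /weight tree_shape_relabel sign_diagram_relabel tree_of_relabel. Qed.

End Relabel.

(** The smaller of two endpoints is counted in the rank of the larger one but not in its own, so the
    inequality is strict. *)
Lemma rank_monotone A : monotone_on (endpoints A) (rank A).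
Proof.
split=> // p q Ep Eq pq lt_pq; rewrite /rank /pos /= -pq.
apply: (sub_count_lt _ Ep); rewrite /= ?eqxx ?ltnn ?andbF //.
by move=> r /= /andP[-> /ltn_trans]; apply.
Qed.

(** Ranks count endpoints in order and the rank map preserves that order, so ranking a second time
    changes nothing. *)
Lemma arrow_diagram_normal_form A : uniq (endpoints A) -> arrow_diagram (normal_form A).
Proof.
move=> uA; have mA := rank_monotone A.
have rankK : {in endpoints A, forall p, rank (normal_form A) (rank A p) = rank A p}.
  move=> p Ap; congr pair; rewrite (permP (perm_endpoints_relabel mA)) count_map.
  apply: eq_in_count => q Aq /=; case: eqP => //= qp.
  exact: monotone_on_ltn mA _ _ Aq Ap qp.
rewrite /arrow_diagram uniq_endpoints_relabel //=; apply/eqP.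
rewrite -[RHS]imfset_id; apply: eq_in_imfset => // a.
move=> /imfsetP[/= b Ab ->].
by rewrite /tl /hd /= !rankK // (mem_endpoints Ab).
Qed.

End Arrows.

(** * Tree diagrams and their trees *)

Section Trees.
Variable n : nat.
Implicit Types (a b : arrow n) (p : point n) (s : seq (arrow n))
  (A R : {fset arrow n}) (I : {set 'I_n}) (i j : 'I_n).

Lemma arrow_relP A i j :
  reflect (exists2 a, a \in A & str (tl a) = i /\ str (hd a) = j) (arrow_rel A i j).
Proof.
apply: (iffP hasP) => -[a Aa]; first by case/andP => /eqP ? /eqP ?; exists a.
by case=> <- <-; exists a; rewrite ?eqxx.
Qed.

(** The single count of [tree_shape] is split: [tails_inj] makes the arrow relation functional, and
    [tailsE] identifies [I]. *)
Record is_tree I j A : Prop := IsTree {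
  loopless : {in A, forall a, str (tl a) <> str (hd a)};
  tails_inj : {in A &, injective (fun a => str (tl a))};
  tailsE : forall i, (i \in I) = (i \in [seq str (tl a) | a <- A]);
  heads_in : {in A, forall a, str (hd a) \in j |: I};
  heads_first : {in A &, forall a b, str (hd b) = str (tl a) ->
                   (pos (hd b) < pos (tl a))%N};
  rooted : forall i, i \in I -> connect (arrow_rel A) i j
}.

Lemma tree_shapeP I j A : reflect (is_tree I j A) (tree_shape I j A).
Proof.
apply: (iffP and5P) => [[/allP h1 /forallP h2 /allP h3 /allP h4 /forallP h5]|[h1 h2 h3 h4 h5 h6]].
  have cE i : count_mem i [seq str (tl a) | a <- A] = (i \in I).
    by rewrite count_map; apply/eqP/h2.
  have mE i : (i \in I) = (i \in [seq str (tl a) | a <- A]).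
    by rewrite -has_pred1 has_count cE; case: (i \in I).
  split => // [a Aa||a b Aa Ab /eqP ab|i Ii]; first exact/eqP/h1.
  - by apply: uniq_map_inj; apply: count_mem_uniq => i; rewrite cE mE.
  - by have /allP/(_ b Ab)/implyP/(_ ab) := h4 a Aa.
  - exact: implyP (h5 i) Ii.
split; [apply/allP => a Aa; exact/eqP/h1| |exact/allP| |].
- apply/forallP => i; rewrite h3 -count_uniq_mem ?count_map //.
  by rewrite map_inj_in_uniq // fset_uniq.
- by apply/allP => a Aa; apply/allP => b Ab; apply/implyP => /eqP; apply: h5.
- by apply/forallP => i; apply/implyP/h6.
Qed.

Lemma mem_incoming A i q : (q \in incoming A i) = arrow_rel A q i.
Proof.
apply/mapP/arrow_relP => -[a]; rewrite ?mem_sort ?mem_filter.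
  by case/andP => /eqP <- Aa ->; exists a.
by move=> Aa [<- <-]; exists a; rewrite ?mem_sort ?mem_filter ?eqxx.
Qed.

(** * Trees without fuel *)

Section Branches.
Variables (I : {set 'I_n}) (j : 'I_n) (A : {fset arrow n}).
Hypotheses (jI : j \notin I) (tA : is_tree I j A).

Lemma uniq_incoming i : uniq (incoming A i).
Proof.
rewrite map_inj_in_uniq ?sort_uniq ?filter_uniq ?fset_uniq // => a b.
rewrite !mem_sort !mem_filter => /andP[_ Aa] /andP[_ Ab]; exact: (tails_inj tA).
Qed.

Lemma tree_functional x y z : arrow_rel A x y -> arrow_rel A x z -> y = z.
Proof.
move=> /arrow_relP[a Aa [ax <-]] /arrow_relP[b Ab [bx <-]].
by rewrite (tails_inj tA Aa Ab) //= ax.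
Qed.

Lemma arrow_rel_tail x y : arrow_rel A x y -> x \in I.
Proof. by case/arrow_relP => a Aa [<- _]; rewrite (tailsE tA) (map_f (fun a => str (tl a))). Qed.

Lemma tree_sink x : ~~ arrow_rel A j x.
Proof. by apply: contra jI => /arrow_rel_tail. Qed.

Lemma tree_rooted x y : arrow_rel A x y -> connect (arrow_rel A) x j.
Proof. by move/arrow_rel_tail/(rooted tA). Qed.

Lemma tree_acyclic x y : arrow_rel A x y -> ~~ connect (arrow_rel A) y x.
Proof. exact: connect_acyclic tree_functional tree_sink tree_rooted x y. Qed.

Lemma tree_child_unique x y q q' : arrow_rel A q y -> arrow_rel A q' y ->
  connect (arrow_rel A) x q -> connect (arrow_rel A) x q' -> q = q'.
Proof. exact: child_unique tree_functional tree_sink tree_rooted x y q q'. Qed.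

Lemma tree_height_child x y :
  arrow_rel A x y -> (height (arrow_rel A) x < height (arrow_rel A) y)%N.
Proof. exact: height_child tree_functional tree_sink tree_rooted x y. Qed.

Lemma eq_in_foldl_vertex (g g' : 'I_n -> rtree n) x r : {in r, g =1 g'} ->
  foldl (fun x q => Vertex x (g q)) x r = foldl (fun x q => Vertex x (g' q)) x r.
Proof.
elim: r x => //= q r IHr x gg'; rewrite gg' ?mem_head // IHr // => q' rq'.
by rewrite gg' // inE rq' orbT.
Qed.

(** A child has strictly fewer descendants than its parent, so fuel beyond the number of descendants
    is never consumed. *)
Lemma branch_stable k k' i :
  (height (arrow_rel A) i <= k)%N -> (height (arrow_rel A) i <= k')%N ->
  branch A k i = branch A k' i.
Proof.
elim: k k' i => [|k IHk] [|k'] i; rewrite ?leqn0 ?(gtn_eqF (height_gt0 _ _)) //= => ik ik'.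
apply: eq_in_foldl_vertex => q; rewrite mem_incoming => /tree_height_child qi.
by apply: IHk; rewrite -ltnS (leq_trans qi).
Qed.

Lemma tree_ofE i : tree_of A i =
  foldl (fun x q => Vertex x (tree_of A q)) (Leaf i) (incoming A i).
Proof.
(* The fuel [n] is generalised to any bound on the heights. Unfolding [branch] once lowers the fuel,
   and [branch_stable] restores it for the children. *)
suff fixpoint N : (forall x, height (arrow_rel A) x <= N)%N -> branch A N i =
    foldl (fun x q => Vertex x (branch A N q)) (Leaf i) (incoming A i).
  by apply: fixpoint => x; rewrite (leq_trans (height_le _ _)) ?card_ord.
case: N => [/(_ i)|N hN] /=; first by rewrite leqNgt height_gt0.
apply: eq_in_foldl_vertex => q; rewrite mem_incoming => /tree_height_child qi.
rewrite -/(branch A N.+1 q); apply: branch_stable => //.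
by rewrite -ltnS (leq_trans qi).
Qed.

End Branches.

Lemma trunk_foldl (g : 'I_n -> rtree n) x r :
  trunk (foldl (fun x q => Vertex x (g q)) x r) = trunk x.
Proof. by elim: r x => //= q r IHr x; rewrite IHr. Qed.

Lemma trunk_tree_of A i : trunk (tree_of A i) = i.
Proof.
suff tr k : trunk (branch A k i) = i by apply: tr.
by case: k => //= k; rewrite trunk_foldl.
Qed.

End Trees.

(** * The three diagrams of the third move *)

Section TriangleTrees.
Variable n : nat.
Implicit Types (a b : arrow n) (p : point n) (s : seq (arrow n))
  (A R : {fset arrow n}) (I : {set 'I_n}) (i j : 'I_n).

Local Notation head_le := (fun a b : arrow n => (pos (hd a) <= pos (hd b))%N).

Definition heads_on R i : seq (arrow n) := sort head_le [seq a <- R | str (hd a) == i].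

Definition incoming_below R i k : seq 'I_n :=
  [seq str (tl a) | a <- heads_on R i & (pos (hd a) < k)%N].

Definition incoming_above R i k : seq 'I_n :=
  [seq str (tl a) | a <- heads_on R i & (k < pos (hd a))%N].

Lemma before_head_trans : transitive (@before_head n).
Proof. by move=> a b c; apply: ltn_trans. Qed.

Lemma mem_heads_on R i a : (a \in heads_on R i) = (str (hd a) == i) && (a \in R).
Proof. by rewrite mem_sort mem_filter. Qed.

(** No head of [R] on string [i] lies in the interval from [lo] to [hi], so the new heads form one
    contiguous block of the sorted list. *)
Lemma incoming_insert A R i s lo hi :
    uniq (endpoints R) ->
    perm_eq [seq a <- A | str (hd a) == i] (s ++ [seq a <- R | str (hd a) == i]) ->
    sorted (@before_head n) s ->
    {in s, forall a, (lo <= pos (hd a) <= hi)%N} -> (lo <= hi)%N ->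
    {in R, forall a, str (hd a) = i -> (pos (hd a) < lo)%N || (hi < pos (hd a))%N} ->
  incoming A i =
    incoming_below R i lo ++ [seq str (tl a) | a <- s] ++ incoming_above R i hi.
Proof.
move=> uR AE ss slh lohi Rlh; rewrite -!map_cat; apply: incoming_unique.
  rewrite perm_sym (permPl AE) perm_sym perm_catCA perm_cat2l.
  rewrite -[X in perm_eq (_ ++ X) _](@eq_in_filter _ (predC (fun a => (pos (hd a) < lo)%N))).
    by rewrite perm_filterC perm_sort.
  move=> a; rewrite mem_heads_on => /andP[/eqP ai Ra] /=; rewrite -leqNgt.
  have := Rlh a Ra ai; case: ltnP => /= [alo _|_ ->] //.
  by apply/esym/negbTE; rewrite -leqNgt (leq_trans (ltnW alo)).
have tr := before_head_trans; have sR := sort_heads i uR; rewrite -/(heads_on R i) in sR.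
rewrite (sorted_pairwise tr) !pairwise_cat -!(sorted_pairwise tr) ss.
rewrite !(sorted_filter tr) // !andbT.
apply/andP; split; apply/allrelP => a b; rewrite ?mem_cat !mem_filter.
  case/andP=> alo _ /orP[/slh/andP[lob _]|/andP[hib _]].
    exact: leq_trans alo lob.
  exact: ltn_trans (leq_trans alo lohi) hib.
by move=> /slh/andP[_ ahi] /andP[hib _]; apply: leq_ltn_trans ahi hib.
Qed.

Lemma mem_tails_fset1U a A i :
  (i \in [seq str (tl b) | b <- a |` A]) =
  (i == str (tl a)) || (i \in [seq str (tl b) | b <- A]).
Proof.
apply/mapP/predU1P => [[b]|[->|/mapP[b Ab ->]]].
- by rewrite !inE => /predU1P[->|Ab ->]; [left|right; rewrite (map_f (fun a => str (tl a)))].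
- by exists a; rewrite // !inE eqxx.
- by exists b; rewrite // !inE Ab orbT.
Qed.

Variables (R : {fset arrow n}) (t m1 m2 b1 b2 : point n).
Hypotheses (uR : uniq ([:: t; m1; m2; b1; b2] ++ endpoints R))
  (m12 : str m1 = str m2) (b12 : str b1 = str b2)
  (lt_m : (pos m1 < pos m2)%N) (lt_b : (pos b1 < pos b2)%N)
  (adj_m : {in endpoints R, forall p, str p = str m1 -> ~~ (pos m1 < pos p < pos m2)%N})
  (adj_b : {in endpoints R, forall p, str p = str b1 -> ~~ (pos b1 < pos p < pos b2)%N}).

(* An abstract function, because conversion would otherwise unfold the finite sets. *)
Variable two_arrows : point n -> point n -> {fset arrow n}.
Hypothesis two_arrowsE : forall p q, two_arrows p q = (t, p) |` ((m2, q) |` R).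

(* The tails are [t] and [m2] in all three; [D1] is the chain t -> m -> b. *)
Local Notation D1 := (two_arrows m1 b2).
Local Notation D2 := (two_arrows b1 b2).
Local Notation D3 := (two_arrows b2 b1).

Lemma two_arrowsP a p q :
  reflect [\/ a = (t, p), a = (m2, q) | a \in R] (a \in two_arrows p q).
Proof.
rewrite two_arrowsE !inE; apply: (iffP or3P) => -[].
- by move/eqP; constructor 1.
- by move/eqP; constructor 2.
- by constructor 3.
- by move=> ->; constructor 1.
- by move=> ->; constructor 2.
- by constructor 3.
Qed.

Lemma mem_two_arrows p q : ((t, p) \in two_arrows p q) * ((m2, q) \in two_arrows p q) *
  {subset R <= two_arrows p q}.
Proof.
split; first by split; apply/two_arrowsP; [constructor 1|constructor 2].
by move=> a Ra; apply/two_arrowsP; constructor 3.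
Qed.

(** Only the heads depend on [p] and [q]. As the tails are distinct points, two of them on one
    string would already violate injectivity for the other choice of heads. *)
Lemma two_arrows_tails_inj p q p' q' :
  {in two_arrows p q &, injective (fun a => str (tl a))} ->
  {in two_arrows p' q' &, injective (fun a => str (tl a))}.
Proof.
move=> inj; have [[tD mD] RD] := mem_two_arrows p q.
have [tm tR mR] : [/\ t != m2, t \notin endpoints R & m2 \notin endpoints R].
  by split; [apply: contraTneq uR => ->|apply: contraL uR => E|apply: contraL uR => E];
    rewrite /= !inE ?E ?eqxx ?orbT /= ?andbF.
have ntm : str t <> str m2.
  by move=> e; have := inj _ _ tD mD e => -[e' _]; rewrite e' eqxx in tm.
have ntR a : a \in R -> str t <> str (tl a).
  move=> Ra e; have e' := inj _ _ tD (RD _ Ra) e; move: tR.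
  by rewrite -[t]/(tl (t, p)) e' (mem_endpoints Ra).
have nmR a : a \in R -> str m2 <> str (tl a).
  move=> Ra e; have e' := inj _ _ mD (RD _ Ra) e; move: mR.
  by rewrite -[m2]/(tl (m2, q)) e' (mem_endpoints Ra).
move=> a b /two_arrowsP[->|->|Ra] /two_arrowsP[->|->|Rb] //= e.
- by case: (ntR b).
- by case: ntm.
- by case: (nmR b).
- by case: (ntR a).
- by case: (nmR a).
- by apply: inj => //; apply: RD.
Qed.

Lemma two_arrows_tailsE p q i :
  (i \in [seq str (tl a) | a <- two_arrows p q]) =
  [|| i == str t, i == str m2 | i \in [seq str (tl a) | a <- R]].
Proof. by rewrite two_arrowsE !mem_tails_fset1U. Qed.

Lemma uniq_rest : uniq (endpoints R).
Proof. by move: uR; rewrite cat_uniq => /and3P[]. Qed.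

Lemma new_points p : p \in [:: t; m1; m2; b1; b2] -> p \notin endpoints R.
Proof. by move: uR; rewrite cat_uniq => /and3P[_ /hasPn nR _]; apply: contraL => /nR. Qed.

Lemma perm_two_arrows p q : perm_eq (two_arrows p q) [:: (t, p), (m2, q) & R].
Proof.
have mR : (m2, q) \notin R.
  apply/negP => /mem_endpoints[+ _].
  by apply/negP; rewrite new_points // !inE eqxx !orbT.
have tR : (t, p) \notin (m2, q) |` R.
  rewrite !inE negb_or; apply/andP; split.
    by apply: contraTneq uR => -[-> _]; rewrite /= !inE eqxx ?orbT.
  apply/negP => /mem_endpoints[+ _].
  by apply/negP; rewrite new_points // !inE eqxx.
by rewrite two_arrowsE; apply: perm_trans (perm_fset1U tR) _; rewrite perm_cons perm_fset1U.
Qed.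

Lemma two_arrows_tails_eq p q p' q' i :
  (i \in [seq str (tl a) | a <- two_arrows p q]) =
  (i \in [seq str (tl a) | a <- two_arrows p' q']).
Proof. exact: etrans (two_arrows_tailsE p q i) (esym (two_arrows_tailsE p' q' i)). Qed.

Lemma two_arrows_rel p q x y : arrow_rel (two_arrows p q) x y =
  [|| (str t == x) && (str p == y), (str m2 == x) && (str q == y) | arrow_rel R x y].
Proof.
apply/arrow_relP/or3P => [[a /two_arrowsP[->|->|Ra] [ax ay]]|].
- by constructor 1; rewrite -ax -ay !eqxx.
- by constructor 2; rewrite -ax -ay !eqxx.
- by constructor 3; apply/arrow_relP; exists a.
have [[tD mD] RD] := mem_two_arrows p q.
case=> [/andP[/eqP<- /eqP<-]|/andP[/eqP<- /eqP<-]|/arrow_relP[a /RD Da ?]].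
- by exists (t, p).
- by exists (m2, q).
- by exists a.
Qed.

Variables (I : {set 'I_n}) (j : 'I_n).
Hypothesis jI : j \notin I.

(** The two heads lie on the same string, so the arrow relation is unchanged; the order condition
    compares tails and heads whose sets, as points, are unchanged too. *)
Lemma is_tree_swap p q : str p = str q ->
  is_tree I j (two_arrows p q) -> is_tree I j (two_arrows q p).
Proof.
move=> pq [h1 h2 h3 h4 h5 h6]; have [[tD mD] RD] := mem_two_arrows p q; split.
- move=> a /two_arrowsP[->|->|/RD/h1//] /=; rewrite ?pq -?pq.
    exact: (h1 _ tD).
  by rewrite pq; exact: (h1 _ mD).
- exact: two_arrows_tails_inj h2.
- by move=> i; apply: etrans (h3 i) _; apply: two_arrows_tails_eq.
- move=> a /two_arrowsP[->|->|Ra]; last exact: (h4 _ (RD _ Ra)).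
    by rewrite /= -pq; exact: (h4 _ tD).
  by rewrite /= pq; exact: (h4 _ mD).
- have tl_old a : a \in two_arrows q p -> exists2 a', a' \in two_arrows p q & tl a = tl a'.
    by case/two_arrowsP=> [->|->|/RD Da]; [exists (t, p)|exists (m2, q)|exists a].
  have hd_old a : a \in two_arrows q p -> exists2 a', a' \in two_arrows p q & hd a = hd a'.
    by case/two_arrowsP=> [->|->|/RD Da]; [exists (m2, q)|exists (t, p)|exists a].
  by move=> a b /tl_old[a' Da' ->] /hd_old[b' Db' ->]; apply: h5.
- move=> i /h6; apply: connect_sub => x y; rewrite two_arrows_rel => xy.
  by apply: connect1; rewrite two_arrows_rel -pq pq in xy *.
Qed.

(** A path through t -> m -> b is shortened to t -> b. The new head [b1] precedes [b2], so it also
    precedes a tail on that string. *)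
Lemma is_tree_chain_trunk : is_tree I j D1 -> is_tree I j D2.
Proof.
move=> tD1; have [h1 h2 h3 h4 h5 h6] := tD1.
have [[tD mD] RD] := mem_two_arrows m1 b2.
have tm : arrow_rel D1 (str t) (str m2) by rewrite two_arrows_rel m12 !eqxx.
have mb : arrow_rel D1 (str m2) (str b2) by rewrite two_arrows_rel !eqxx orbT.
split.
- move=> a /two_arrowsP[->|->|/RD/h1//] /=; last exact: (h1 _ mD).
  (* If t and b were the same string, the chain t -> m -> b would be a cycle. *)
  move=> tb; have := tree_acyclic jI tD1 tm; rewrite tb b12 => /negP[].
  exact: connect1.
- exact: two_arrows_tails_inj h2.
- by move=> i; apply: etrans (h3 i) _; apply: two_arrows_tails_eq.
- move=> a /two_arrowsP[->|->|Ra]; [|exact: (h4 _ mD)|exact: (h4 _ (RD _ Ra))].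
  by rewrite /= b12; exact: (h4 _ mD).
- have tl_old a : a \in D2 -> exists2 a', a' \in D1 & tl a = tl a'.
    by case/two_arrowsP=> [->|->|/RD Da]; [exists (t, m1)|exists (m2, b2)|exists a].
  have hd_old a : a \in D2 -> exists2 a', a' \in D1 &
      str (hd a) = str (hd a') /\ (pos (hd a) <= pos (hd a'))%N.
    case/two_arrowsP=> [->|->|/RD Da]; [|by exists (m2, b2)|by exists a].
    by exists (m2, b2); rewrite //= ltnW.
  move=> a b /tl_old[a' Da' ->] /hd_old[b' Db' [-> le]] ab.
  exact: leq_ltn_trans le (h5 _ _ Da' Db' ab).
- move=> i /h6/connectP[s]; elim: s i => [|x s IHs] i /= => [_ ->|/andP[ix xs] jE].
    exact: connect0.
  have xj := IHs x xs jE; move: ix; rewrite two_arrows_rel.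
  case/or3P=> [/andP[/eqP ti /eqP mx]|/andP[/eqP mi /eqP bx]|Rix].
  (* The edge used is t -> m, which is gone. String m carries a tail, so it is not the trunk, and
     the path must continue to b; t now reaches b directly. *)
  + move: xj; rewrite -mx m12 -ti => /connect_head[mj|[z]].
      by move: jI; rewrite -mj (arrow_rel_tail tD1 mb).
    rewrite two_arrows_rel => /or3P[/andP[/eqP tm' _]|/andP[_ /eqP <-] bj|Rmz].
    * by have := tree_acyclic jI tD1 tm; rewrite tm' => /negP[]; apply: connect0.
    * by apply: connect_trans bj; apply: connect1; rewrite two_arrows_rel b12 !eqxx.
    * suff -> : z = str b2.
        by apply: connect_trans; apply: connect1; rewrite two_arrows_rel b12 !eqxx.
      by apply: (tree_functional tD1 _ mb); rewrite two_arrows_rel Rmz !orbT.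
  + apply: connect_trans xj; apply: connect1.
    by rewrite two_arrows_rel mi bx !eqxx orbT.
  + by apply: connect_trans xj; apply: connect1; rewrite two_arrows_rel Rix !orbT.
Qed.

(** The arrow t -> b is replaced by the detour t -> m -> b; t and m are different strings because
    both carry a tail. *)
Lemma is_tree_trunk_chain : is_tree I j D2 -> is_tree I j D1.
Proof.
move=> tD2; have [h1 h2 h3 h4 h5 h6] := tD2.
have [[tD mD] RD] := mem_two_arrows b1 b2.
have [[tD1 mD1] RD1] := mem_two_arrows m1 b2.
have h2' := two_arrows_tails_inj (p' := m1) (q' := b2) h2.
split.
- move=> a /two_arrowsP[->|->|/RD/h1//] /=; last exact: (h1 _ mD).
  by rewrite m12 => /(h2' _ _ tD1 mD1)[tm _]; move: uR; rewrite tm /= !inE eqxx !orbT.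
- exact: h2'.
- by move=> i; apply: etrans (h3 i) _; apply: two_arrows_tails_eq.
- move=> a /two_arrowsP[->|->|Ra]; [|exact: (h4 _ mD)|exact: (h4 _ (RD _ Ra))].
  by rewrite /= m12 !inE h3 two_arrows_tailsE eqxx !orbT.
- have old a : a \in D1 -> a = (t, m1) \/ exists2 a', a' \in D2 & hd a = hd a'.
    case/two_arrowsP=> [->|->|/RD Da]; [by left|right|right].
      by exists (m2, b2).
    by exists a.
  have tl_old a : a \in D1 -> exists2 a', a' \in D2 & tl a = tl a'.
    by case/two_arrowsP=> [->|->|/RD Da]; [exists (t, b1)|exists (m2, b2)|exists a].
  move=> a b Da /old[->|[b' Db' ->]] /= ab.
    (* The only tail on string m is [m2], and [m1] lies before it: here the order of the two
       endpoints on m is decisive. *)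
    by have <- := h2' _ _ mD1 Da; rewrite //= -m12.
  by have [a' Da' aa'] := tl_old a Da; rewrite aa' in ab *; apply: h5.
- move=> i /h6; apply: connect_sub => x y; rewrite two_arrows_rel.
  case/or3P => [/andP[/eqP<- /eqP<-]|/andP[/eqP<- /eqP<-]|Rxy].
  + apply: (@connect_trans _ _ (str m2)); apply: connect1.
      by rewrite two_arrows_rel m12 !eqxx.
    by rewrite two_arrows_rel b12 !eqxx orbT.
  + by apply: connect1; rewrite two_arrows_rel !eqxx orbT.
  + by apply: connect1; rewrite two_arrows_rel Rxy !orbT.
Qed.

Lemma tree_shape_triangle :
  (tree_shape I j D1 = tree_shape I j D2) * (tree_shape I j D3 = tree_shape I j D2).
Proof.
split; apply/tree_shapeP/tree_shapeP.
- exact: is_tree_chain_trunk.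
- exact: is_tree_trunk_chain.
- exact: is_tree_swap.
- exact: is_tree_swap.
Qed.

Lemma incoming_other p q i : i != str p -> i != str q ->
  incoming (two_arrows p q) i = incoming R i.
Proof.
move=> ip iq; apply: incoming_unique (sort_heads i uniq_rest).
rewrite perm_sort perm_sym (perm_trans (perm_filter _ (perm_two_arrows p q))) //=.
by rewrite !(eq_sym _ i) (negPf ip) (negPf iq).
Qed.

(** [adj_b] excludes only the open interval; its two ends are excluded because [b1] and [b2] are not
    endpoints of [R]. *)
Lemma outside_pair p : p \in endpoints R -> str p = str b2 ->
  (pos p < pos b1)%N || (pos b2 < pos p)%N.
Proof.
move=> Rp pb; have := adj_b Rp; rewrite b12 => /(_ pb).
have neq (q : point n) : q \in [:: b1; b2] -> str q = str b2 -> pos p != pos q.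
  move=> q12 qb; apply/eqP => e; suff pq : p = q.
    have: q \in [:: t; m1; m2; b1; b2] by rewrite (mem_cat q [:: t; m1; m2] [:: b1; b2]) q12 orbT.
    by move/new_points; rewrite -pq Rp.
  by move: pb qb e; rewrite /str /pos; case: (p) (q) => ? ? [? ?] /= -> -> ->.
have n1 : pos p != pos b1 by apply: neq; rewrite // !inE eqxx.
have n2 : pos p != pos b2 by apply: neq; rewrite // !inE eqxx orbT.
by case: ltngtP n1 => //= _ _; case: ltngtP n2.
Qed.

Lemma incoming_trunk p q s :
    sorted (@before_head n) s ->
    perm_eq [seq a <- [:: (t, p); (m2, q)] | str (hd a) == str b2] s ->
    {in s, forall a, (pos b1 <= pos (hd a) <= pos b2)%N} ->
  incoming (two_arrows p q) (str b2) =
  incoming_below R (str b2) (pos b1) ++ [seq str (tl a) | a <- s] ++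
  incoming_above R (str b2) (pos b2).
Proof.
move=> ss ps hs; apply: incoming_insert uniq_rest _ ss hs (ltnW lt_b) _.
  rewrite (perm_trans (perm_filter _ (perm_two_arrows p q))) //.
  by rewrite -(cat1s (t, p)) -(cat1s (m2, q)) catA filter_cat perm_cat2r.
by move=> a Ra; apply: outside_pair; rewrite (mem_endpoints Ra).
Qed.

(** * The trees of the three diagrams *)

Section Chain.
Hypothesis tD1 : is_tree I j D1.

Let tD2 : is_tree I j D2 := is_tree_chain_trunk tD1.
Let tD3 : is_tree I j D3 := is_tree_swap b12 tD2.

Lemma chain_loopless : str m2 != str b2.
Proof. by have [[_ mD] _] := mem_two_arrows m1 b2; apply/eqP/(loopless tD1 mD). Qed.

Lemma chain_arrows :
  arrow_rel D1 (str t) (str m2) /\ arrow_rel D1 (str m2) (str b2).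
Proof. by rewrite !two_arrows_rel m12 !eqxx orbT. Qed.

(** All heads on m precede the tail [m2] and none lies between [m1] and [m2], so the branch from t
    is attached last, on top of the complete subtree of m. *)
Lemma incoming_chain_middle : incoming D1 (str m2) = incoming R (str m2) ++ [:: str t].
Proof.
rewrite (@incoming_unique _ _ _ (heads_on R (str m2) ++ [:: (t, m1)])) ?map_cat //.
  rewrite perm_sym (perm_trans (perm_filter _ (perm_two_arrows m1 b2))) //=.
  rewrite m12 eqxx (negPf (introN eqP _)) //; last first.
    by move/esym/eqP; rewrite (negPf chain_loopless).
  by rewrite cats1 perm_sym perm_rcons perm_cons perm_sort.
have tr := before_head_trans.
rewrite (sorted_pairwise tr) pairwise_cat -!(sorted_pairwise tr) sort_heads ?uniq_rest //.
rewrite !andbT; apply/allrelP => a b; rewrite mem_heads_on inE => /andP[/eqP am Ra] /eqP->.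
have [[_ mD] RD] := mem_two_arrows m1 b2; have [_ Rh] := mem_endpoints Ra.
have lt2 := heads_first tD1 mD (RD _ Ra) am.
have := adj_m Rh; rewrite m12 => /(_ am).
rewrite lt2 andbT -leqNgt leq_eqVlt => /predU1P[e|//].
have: hd a \in [:: t; m1; m2; b1; b2].
  suff -> : hd a = m1 by rewrite !inE eqxx orbT.
  by case: (hd a) m1 am m12 e => ? ? [? ?]; rewrite /str /pos /= => -> -> ->.
by move/new_points; rewrite Rh.
Qed.

Lemma incoming_trunk_middle p q : str p = str b2 -> str q = str b2 ->
  incoming (two_arrows p q) (str m2) = incoming R (str m2).
Proof. by move=> pb qb; rewrite incoming_other ?pb ?qb ?chain_loopless. Qed.

Lemma incoming_chain : incoming D1 (str b2) =
  incoming_below R (str b2) (pos b1) ++ [:: str m2] ++ incoming_above R (str b2) (pos b2).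
Proof.
rewrite (@incoming_trunk _ _ [:: (m2, b2)]) //=.
  by rewrite m12 (negPf chain_loopless) eqxx.
by move=> a; rewrite inE => /eqP-> /=; rewrite leqnn ltnW.
Qed.

Lemma incoming_trunk12 : incoming D2 (str b2) =
  incoming_below R (str b2) (pos b1) ++ [:: str t; str m2] ++
  incoming_above R (str b2) (pos b2).
Proof.
rewrite (@incoming_trunk _ _ [:: (t, b1); (m2, b2)]) //=.
- by rewrite andbT.
- by rewrite b12 eqxx.
- by move=> a; rewrite !inE => /orP[] /eqP-> /=; rewrite leqnn ltnW.
Qed.

Lemma incoming_trunk21 : incoming D3 (str b2) =
  incoming_below R (str b2) (pos b1) ++ [:: str m2; str t] ++
  incoming_above R (str b2) (pos b2).
Proof.
rewrite (@incoming_trunk _ _ [:: (m2, b1); (t, b2)]) //=.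
- by rewrite andbT.
- by rewrite b12 eqxx -[X in perm_eq X _]/([:: _] ++ [:: _]) perm_catC.
- by move=> a; rewrite !inE => /orP[] /eqP-> /=; rewrite leqnn ltnW.
Qed.

(** The strings on the path from m to the root, m included: the only ones whose subtree the move can
    affect. *)
Local Notation above_middle i := (connect (arrow_rel D1) (str m2) i).

Lemma incoming_off_middle p q i : str p = str b2 -> str q = str b2 ->
  ~~ above_middle i -> incoming (two_arrows p q) i = incoming D1 i.
Proof.
move=> pb qb nmi; have [_ mb] := chain_arrows.
have im : i != str m2 by apply: contraNneq nmi => ->; rewrite connect0.
have ib : i != str b2 by apply: contraNneq nmi => ->; apply: connect1.
by rewrite !incoming_other ?pb ?qb ?m12.
Qed.

Lemma off_middle_child i q : ~~ above_middle i -> arrow_rel D1 q i -> ~~ above_middle q.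
Proof. by move=> nmi qi; apply: contra nmi => /connect_trans; apply; apply: connect1. Qed.

(** Induction on the number of descendants: off the path the lists of branches agree, and children
    of such strings are again off the path. *)
Lemma tree_of_off_middle p q i : str p = str b2 -> str q = str b2 ->
  is_tree I j (two_arrows p q) -> ~~ above_middle i ->
  tree_of (two_arrows p q) i = tree_of D1 i.
Proof.
move=> pb qb tpq; move: {2}(height _ _) (leqnn (height (arrow_rel D1) i)) => h.
elim: h i => [|h IHh] i; first by rewrite leqn0 (gtn_eqF (height_gt0 _ _)).
move=> ih nmi; rewrite (tree_ofE jI tpq) (tree_ofE jI tD1) incoming_off_middle //.
apply: eq_in_foldl_vertex => x; rewrite mem_incoming => xi.
apply: IHh; last exact: off_middle_child xi.
by rewrite -ltnS (leq_trans (tree_height_child jI tD1 xi)).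
Qed.

Lemma plug_foldl (g : 'I_n -> rtree n) C u r :
  foldl (fun x q => Vertex x (g q)) (plug C u) r =
  plug (foldl (fun C q => OnTrunk C (g q)) C r) u.
Proof. by elim: r C => //= q r IHr C; rewrite -IHr. Qed.

Local Notation attach A r z := (foldl (fun x q => Vertex x (tree_of A q)) z r).

(** [X] is the part of string b before the two adjacent points, [M] is m without the branch from t,
    and [T] is that branch. All are taken in [D1], since the other two diagrams give the same trees
    there. *)
Let X := attach D1 (incoming_below R (str b2) (pos b1)) (Leaf (str b2)).
Let M := attach D1 (incoming R (str m2)) (Leaf (str m2)).
Let T := tree_of D1 (str t).

Lemma above_middleE q : above_middle q -> q = str m2 \/ connect (arrow_rel D1) (str b2) q.
Proof.
have [_ mb] := chain_arrows.
by case/connect_head=> [->|[z mz]]; [left|rewrite (tree_functional tD1 mz mb); right].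
Qed.

Lemma rest_rel q i : arrow_rel R q i -> arrow_rel D1 q i.
Proof. by move=> Rqi; rewrite two_arrows_rel Rqi !orbT. Qed.

Lemma middle_off_rest i : ~~ arrow_rel R (str m2) i.
Proof.
have [[_ mD] RD] := mem_two_arrows m1 b2.
apply/negP => /arrow_relP[a Ra [am _]]; have aE := tails_inj tD1 (RD _ Ra) mD am.
have : m2 \in endpoints R by have [] := mem_endpoints Ra; rewrite aE.
by apply/negP/new_points; rewrite !inE eqxx !orbT.
Qed.

Lemma rest_child_off_middle q : arrow_rel R q (str b2) -> ~~ above_middle q.
Proof.
move=> qb; apply/negP => /above_middleE[qm|bq].
  by move: (middle_off_rest (str b2)); rewrite -qm qb.
by have := tree_acyclic jI tD1 (rest_rel qb); rewrite bq.
Qed.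

Lemma attach_off_middle p q r x : str p = str b2 -> str q = str b2 ->
  is_tree I j (two_arrows p q) -> {in r, forall i, ~~ above_middle i} ->
  attach (two_arrows p q) r x = attach D1 r x.
Proof.
move=> pb qb tpq nmr; apply: eq_in_foldl_vertex => i /nmr.
exact: tree_of_off_middle.
Qed.

Lemma top_off_middle : ~~ above_middle (str t).
Proof. by have [/(tree_acyclic jI tD1)] := chain_arrows. Qed.

Lemma tree_of_chain_middle : tree_of D1 (str m2) = Vertex M T.
Proof. by rewrite (tree_ofE jI tD1) incoming_chain_middle foldl_cat. Qed.

Lemma tree_of_trunk_middle p q : str p = str b2 -> str q = str b2 ->
  is_tree I j (two_arrows p q) -> tree_of (two_arrows p q) (str m2) = M.
Proof.
move=> pb qb tpq; rewrite (tree_ofE jI tpq) incoming_trunk_middle //.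
apply: attach_off_middle => // i; rewrite mem_incoming => /rest_rel.
exact: (tree_acyclic jI tD1).
Qed.

Lemma incoming_rest_sub k : {subset incoming_below R (str b2) k ++
  incoming_above R (str b2) k <= [pred q | arrow_rel R q (str b2)]}.
Proof.
move=> q; rewrite mem_cat => /orP[] /mapP[a + ->]; rewrite mem_filter mem_heads_on;
  by case/and3P=> _ /eqP ab Ra; apply/arrow_relP; exists a.
Qed.

Lemma below_off_middle : {in incoming_below R (str b2) (pos b1), forall i, ~~ above_middle i}.
Proof.
move=> i bi; apply/rest_child_off_middle/(incoming_rest_sub (k := pos b1)).
by rewrite mem_cat bi.
Qed.

Lemma above_off_middle : {in incoming_above R (str b2) (pos b2), forall i, ~~ above_middle i}.
Proof.
move=> i bi; apply/rest_child_off_middle/(incoming_rest_sub (k := pos b2)).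
by rewrite mem_cat bi orbT.
Qed.

(** Induction along the path from b to [i]. One context must serve all three trees, so the statement
    carries them together. *)
Lemma tree_of_triangle i : connect (arrow_rel D1) (str b2) i ->
  exists C, [/\ tree_of D1 i = plug C (Vertex X (Vertex M T)),
    tree_of D2 i = plug C (Vertex (Vertex X T) M)
  & tree_of D3 i = plug C (Vertex (Vertex X M) T)].
Proof.
have [tm mb] := chain_arrows.
move: {2}(height _ _) (leqnn (height (arrow_rel D1) i)) => h.
elim: h i => [|h IHh] i; first by rewrite leqn0 (gtn_eqF (height_gt0 _ _)).
move=> ih bi; have [->|ib] := eqVneq i (str b2).
  (* At b itself the context consists of the branches attached after [b2]. *)
  exists (foldl (fun C q => OnTrunk C (tree_of D1 q)) (@Hole n)
            (incoming_above R (str b2) (pos b2))).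
  rewrite -!plug_foldl /=; split.
  - by rewrite (tree_ofE jI tD1) incoming_chain !foldl_cat /= tree_of_chain_middle.
  - rewrite (tree_ofE jI tD2) incoming_trunk12 !foldl_cat /=.
    rewrite (attach_off_middle _ b12 (erefl _) tD2 above_off_middle).
    rewrite (attach_off_middle _ b12 (erefl _) tD2 below_off_middle).
    by rewrite tree_of_trunk_middle // tree_of_off_middle // top_off_middle.
  - rewrite (tree_ofE jI tD3) incoming_trunk21 !foldl_cat /=.
    rewrite (attach_off_middle _ (erefl _) b12 tD3 above_off_middle).
    rewrite (attach_off_middle _ (erefl _) b12 tD3 below_off_middle).
    by rewrite tree_of_trunk_middle // tree_of_off_middle // top_off_middle.
have im : i != str m2.
  by apply: contraTneq bi => ->; apply: (tree_acyclic jI tD1 mb).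
have [q qi bq] : exists2 q, arrow_rel D1 q i & connect (arrow_rel D1) (str b2) q.
  case/connectP: bi => s; case/lastP: s => [|s x] /=.
    by move=> _ e; rewrite e eqxx in ib.
  rewrite rcons_path last_rcons => /andP[bs sx] ->; exists (last (str b2) s) => //.
  by apply/connectP; exists s.
have incD x y : str x = str b2 -> str y = str b2 ->
    incoming (two_arrows x y) i = incoming D1 i.
  by move=> xb yb; rewrite !incoming_other ?xb ?yb ?m12.
have [C [e1 e2 e3]] : exists C, [/\ tree_of D1 q = plug C (Vertex X (Vertex M T)),
    tree_of D2 q = plug C (Vertex (Vertex X T) M)
  & tree_of D3 q = plug C (Vertex (Vertex X M) T)].
  by apply: IHh; rewrite // -ltnS (leq_trans (tree_height_child jI tD1 qi)).
have qinc : q \in incoming D1 i by rewrite mem_incoming.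
have := uniq_incoming tD1 i; have incR x : x \in incoming D1 i -> arrow_rel D1 x i.
  by rewrite mem_incoming.
rewrite (tree_ofE jI tD1) (tree_ofE jI tD2) (tree_ofE jI tD3) !incD //.
case/splitPr: qinc incR => r1 r2 incR.
rewrite -cat1s uniq_catCA cat1s cons_uniq => /andP[nq _].
(* Any other child on the path from m is impossible: m is a child only of b, and a child reached
   from b coincides with [q] by [tree_child_unique]. *)
have off : {in r1 ++ r2, forall x, ~~ above_middle x}.
  move=> x xr; have xi : arrow_rel D1 x i.
    by apply: incR; move: xr; rewrite !mem_cat inE => /orP[]->; rewrite ?orbT.
  apply/negP => /above_middleE[xm|bx].
    by rewrite xm in xi; move: ib; rewrite (tree_functional tD1 xi mb) eqxx.
  have xq := tree_child_unique jI tD1 xi qi bx bq.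
  by rewrite -xq xr in nq.
have off1 : {in r1, forall x, ~~ above_middle x} by move=> x r1x; rewrite off ?mem_cat ?r1x.
have off2 : {in r2, forall x, ~~ above_middle x}.
  by move=> x r2x; rewrite off ?mem_cat ?r2x ?orbT.
exists (foldl (fun C q => OnTrunk C (tree_of D1 q)) (OnBranch (attach D1 r1 (Leaf i)) C) r2).
rewrite -!plug_foldl /= !foldl_cat /= e1 e2 e3; split=> //.
  by rewrite !(attach_off_middle _ b12 (erefl _) tD2).
by rewrite !(attach_off_middle _ (erefl _) b12 tD3).
Qed.

Lemma trunk_triangle : [/\ trunk X = str b2, trunk M = str m2 & trunk T = str t].
Proof. by rewrite /X /M /T !trunk_foldl trunk_tree_of. Qed.

Lemma chain_uniq : uniq [:: str b2; str m2; str t].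
Proof.
have [tm mb] := chain_arrows; rewrite /= !inE negb_or andbT eq_sym chain_loopless /=.
apply/andP; split.
  by apply: contraNneq (tree_acyclic jI tD1 tm) => <-; apply: connect1.
by apply: contraNneq (tree_acyclic jI tD1 tm) => ->; apply: connect0.
Qed.

Lemma chain_root : connect (arrow_rel D1) (str b2) j.
Proof.
have [[_ mD] _] := mem_two_arrows m1 b2.
have := heads_in tD1 mD; rewrite !inE => /predU1P[/= ->|]; first exact: connect0.
exact: (rooted tD1).
Qed.

End Chain.

Lemma sign_two_arrows p q : sign_diagram (two_arrows p q) =
  sign_diagram R * (right_sign (str t) (str p) * right_sign (str m2) (str q)).
Proof.
rewrite /sign_diagram (permP (perm_two_arrows p q)) /= !exprD /right_sign.
by rewrite mulrA mulrC.
Qed.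

Lemma weight_triangle : weight I j D1 + weight I j D2 = weight I j D3.
Proof.
rewrite /weight !tree_shape_triangle -tree_shape_triangle.1.
case: tree_shapeP => [tD1|_]; last by rewrite addr0.
have [C [-> -> ->]] := tree_of_triangle tD1 (chain_root tD1).
set X := foldl _ _ _; set M := foldl _ _ (incoming R _); set T := tree_of D1 _.
have [Xb Mm Tt] := trunk_triangle; rewrite -/X -/M -/T in Xb Mm Tt.
have := @omega3_trees _ _ C X M T (enum_increasing (j |: I)).
rewrite Xb Mm Tt => /(_ (chain_uniq tD1)) triangle.
rewrite !sign_two_arrows m12 b12 !(mulrC (sign_diagram R)).
by rewrite 3![_ *~ (_ * sign_diagram R)]mulrzA -mulrzDl triangle.
Qed.

End TriangleTrees.

(** * Sliding an endpoint across a gap *)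

Section Sliding.
Variable n : nat.
Implicit Types (a b : arrow n) (p q h r : point n) (E : seq (point n))
  (B F : {fset arrow n}) (I : {set 'I_n}) (j : 'I_n).

(** Symmetric in [p] and [q]. Only strict betweenness is excluded, so [p] and [q] may themselves
    occur in [E]. *)
Definition gap E p q := str p = str q /\ {in E, forall r, str r = str p ->
  ~~ (pos p < pos r < pos q)%N && ~~ (pos q < pos r < pos p)%N}.

Lemma gap_sym E p q : gap E p q -> gap E q p.
Proof. by case=> pq gE; split=> // r Er rp; rewrite andbC gE // pq. Qed.

Lemma gapS E E' p q : {subset E' <= E} -> gap E p q -> gap E' p q.
Proof. by move=> sE [pq gE]; split=> // r /sE; apply: gE. Qed.

Definition slide p q r := if r == p then q else r.

Lemma point_eq p q : str p = str q -> pos p = pos q -> p = q.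
Proof. by case: p q => ? ? [? ?]; rewrite /str /pos /= => -> ->. Qed.

Lemma slide_monotone E p q : q \notin E -> gap E p q -> monotone_on E (slide p q).
Proof.
move=> nq [pq gE]; split=> [r|x y Ex Ey xy].
  by rewrite /slide; case: eqP => // ->.
have neq z : z \in E -> str z = str p -> pos z <> pos q.
  move=> Ez zp e; have /eqP := point_eq (etrans zp pq) e.
  by apply/negP; apply: contraNneq nq => <-.
rewrite /slide; case: eqP => [xp|xp]; case: eqP => [yp|yp] //.
- by rewrite xp yp ltnn.
- have yp' : str y = str p by rewrite -xy xp.
  by move: (gE y Ey yp') (neq y Ey yp'); rewrite xp; lia.
- have xp' : str x = str p by rewrite xy yp.
  by move: (gE x Ex xp') (neq x Ex xp'); rewrite yp; lia.
Qed.

Lemma relabel_id (f : point n -> point n) F :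
  {in endpoints F, forall p, f p = p} -> relabel f F = F.
Proof.
move=> fK; rewrite -[RHS]imfset_id; apply: eq_in_imfset => // a Fa.
by rewrite !fK ?(mem_endpoints Fa) //; case: a Fa.
Qed.

Lemma relabel_fset1U (f : point n -> point n) a F :
  relabel f (a |` F) = (f (tl a), f (hd a)) |` relabel f F.
Proof. by rewrite /relabel imfsetU1. Qed.

(** An inequality, so that no case distinction on whether [a] is already in [F] is needed later. *)
Lemma count_endpoints_fset1U (P : pred (point n)) a F :
  (count P (endpoints (a |` F)) <= count P [:: tl a, hd a & endpoints F])%N.
Proof.
have [Fa|Fa] := boolP (a \in F); last by rewrite (permP (endpoints_fset1U Fa)).
by rewrite (fsetUidPr _ _ _) ?fsub1set //=; lia.
Qed.

(** Reduces distinctness of rearranged lists of endpoints to linear inequalities between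
    multiplicities. *)
Lemma uniq_le_count (T : eqType) (s1 s2 : seq T) : uniq s2 ->
  (forall x, count_mem x s1 <= count_mem x s2)%N -> uniq s1.
Proof.
move=> u2 le12; apply: count_mem_uniq => x; apply/eqP; rewrite eqn_leq -has_pred1 has_count.
rewrite andbC; case: (count _ _) (le12 x) => //= k le; rewrite (leq_trans le) //.
by rewrite count_uniq_mem // leq_b1.
Qed.

Lemma mem_endpoints_fset1U a F :
  {subset endpoints (a |` F) <= [:: tl a, hd a & endpoints F]}.
Proof.
move=> x; rewrite -!has_pred1 !has_count => lt; exact: leq_trans lt (count_endpoints_fset1U _ _ _).
Qed.

Section Slides.
Variables (I : {set 'I_n}) (j : 'I_n) (E : seq (point n)) (p q h : point n)
  (F : {fset arrow n}).
Hypotheses (u : uniq ([:: p; q; h] ++ endpoints F)) (g : gap E p q)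
  (sE : {subset h :: endpoints F <= E}).

Let slide_props : [/\ slide p q h = h, relabel (slide p q) F = F
  & monotone_on [:: p, h & endpoints F] (slide p q)].
Proof.
have [ph pF qF] : [/\ h != p, p \notin endpoints F & q \notin [:: p, h & endpoints F]].
  split; [apply: contraTneq u => ->|apply: contraL u => e|apply: contraL u].
  - by rewrite /= !inE eqxx !orbT.
  - by rewrite /= !inE e !orbT.
  - by rewrite /= !inE => /or3P[/eqP->|/eqP->|->]; rewrite ?eqxx ?orbT /= ?andbF.
split.
- by rewrite /slide (negPf ph).
- by apply: relabel_id => x Fx; rewrite /slide ifN //; apply: contraNneq pF => <-.
- apply: slide_monotone => //; case: g => pq gE; split => // r.
  rewrite inE => /predU1P[-> _|/sE Er]; last exact: gE.
  by rewrite !ltnn andbF.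
Qed.

(** [slide] fixes all other endpoints and preserves order across the gap, so this is an instance of
    [weight_relabel]. *)
Lemma weight_slide_tail : weight I j ((p, h) |` F) = weight I j ((q, h) |` F).
Proof.
have [sh sF mono] := slide_props.
have -> : (q, h) |` F = relabel (slide p q) ((p, h) |` F).
  by rewrite relabel_fset1U sF sh /slide /= eqxx.
rewrite weight_relabel //.
  apply: uniq_le_count u _ => x; apply: leq_trans (count_endpoints_fset1U _ _ _) _.
  by rewrite /=; lia.
by case: mono => ? m; split=> // x y /mem_endpoints_fset1U Ex /mem_endpoints_fset1U Ey; apply: m.
Qed.

Lemma weight_slide_head : weight I j ((h, p) |` F) = weight I j ((h, q) |` F).
Proof.
have [sh sF mono] := slide_props.
have -> : (h, q) |` F = relabel (slide p q) ((h, p) |` F).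
  by rewrite relabel_fset1U sF sh /slide /= eqxx.
have sub : {subset endpoints ((h, p) |` F) <= [:: p, h & endpoints F]}.
  by move=> x /mem_endpoints_fset1U; rewrite !inE /= orbCA.
rewrite weight_relabel //.
  apply: uniq_le_count u _ => x; apply: leq_trans (count_endpoints_fset1U _ _ _) _.
  by rewrite /=; lia.
by case: mono => ? m; split=> // x y /sub Ex /sub Ey; apply: m.
Qed.

End Slides.

Lemma weight_loop I j B a : a \in B -> str (tl a) = str (hd a) -> weight I j B = 0.
Proof.
by rewrite /weight => Ba e; case: tree_shapeP => // /loopless/(_ a Ba).
Qed.

Lemma weight_two_tails I j B a b : a \in B -> b \in B -> a != b ->
  str (tl a) = str (tl b) -> weight I j B = 0.
Proof.
rewrite /weight => Ba Bb nab e; case: tree_shapeP => // /tails_inj/(_ a b Ba Bb e).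
by move/eqP; rewrite (negPf nab).
Qed.

Lemma weight_late_head I j B a b : a \in B -> b \in B ->
  str (hd b) = str (tl a) -> (pos (tl a) <= pos (hd b))%N -> weight I j B = 0.
Proof.
rewrite /weight => Ba Bb e le; case: tree_shapeP => // /heads_first/(_ a b Ba Bb e).
by rewrite ltnNge le.
Qed.

(** A single arrow slides at both ends. The pairs are brought to the common tails [t2] and [m2]; in
    the last pair the tail on m is free to move because t -> m is absent. *)
Lemma weight_omega3 I j (t1 t2 m1 m2 b1 b2 : point n) B :
    let E := [:: t1; t2; m1; m2; b1; b2] ++ endpoints B in
    j \notin I -> uniq E -> gap E t1 t2 -> gap E m1 m2 -> gap E b1 b2 ->
    (pos m1 < pos m2)%N -> (pos b1 < pos b2)%N ->
  let w F := weight I j F in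
  [/\ w ((t1, m1) |` B) = w ((t2, m2) |` B),
      w ((t2, b1) |` B) = w ((t1, b2) |` B),
      w ((m2, b2) |` B) = w ((m1, b1) |` B)
    & w ((t1, m1) |` ((m2, b2) |` B)) + w ((t2, b1) |` ((m2, b2) |` B)) =
      w ((t1, b2) |` ((m1, b1) |` B))].
Proof.
move=> E jI uE gt gm gb ltm ltb w.
have EB : {subset endpoints B <= E} by move=> x Bx; rewrite mem_cat Bx orbT.
have E6 x : x \in [:: t1; t2; m1; m2; b1; b2] -> x \in E by rewrite mem_cat => ->.
have EU a F : {subset endpoints F <= E} -> tl a \in E -> hd a \in E ->
    {subset endpoints (a |` F) <= E}.
  by move=> FE Ea Eh x /mem_endpoints_fset1U; rewrite !inE => /or3P[/eqP->|/eqP->|/FE].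
have Econs x F : x \in E -> {subset endpoints F <= E} -> {subset x :: endpoints F <= E}.
  by move=> Ex FE y; rewrite inE => /predU1P[->|/FE].
have U s1 : (forall x, count_mem x s1 <= count_mem x E)%N -> uniq s1.
  exact: uniq_le_count uE.
have E6' x F : x \in [:: t1; t2; m1; m2; b1; b2] -> {subset endpoints F <= E} ->
    {subset x :: endpoints F <= E}.
  by move=> /E6; apply: Econs.
have in1 : t1 \in [:: t1; t2; m1; m2; b1; b2] by rewrite !inE eqxx.
have in2 : t2 \in [:: t1; t2; m1; m2; b1; b2] by rewrite !inE eqxx orbT.
have in3 : m1 \in [:: t1; t2; m1; m2; b1; b2] by rewrite !inE eqxx !orbT.
have in4 : m2 \in [:: t1; t2; m1; m2; b1; b2] by rewrite !inE eqxx !orbT.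
have in5 : b1 \in [:: t1; t2; m1; m2; b1; b2] by rewrite !inE eqxx !orbT.
have in6 : b2 \in [:: t1; t2; m1; m2; b1; b2] by rewrite !inE eqxx !orbT.
have slide_tail p q h F := @weight_slide_tail I j E p q h F.
have slide_head p q h F := @weight_slide_head I j E p q h F.
rewrite /w; split.
- transitivity (weight I j ((t2, m1) |` B)).
    by apply: (slide_tail _ _ _ _ (U _ _) gt (E6' _ _ in3 EB)) => x /=; clear; lia.
  by apply: (slide_head _ _ _ _ (U _ _) gm (E6' _ _ in2 EB)) => x /=; clear; lia.
- transitivity (weight I j ((t1, b1) |` B)).
    by apply: (slide_tail _ _ _ _ (U _ _) (gap_sym gt) (E6' _ _ in5 EB)) => x /=; clear; lia.
  by apply: (slide_head _ _ _ _ (U _ _) gb (E6' _ _ in1 EB)) => x /=; clear; lia.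
- transitivity (weight I j ((m1, b2) |` B)).
    by apply: (slide_tail _ _ _ _ (U _ _) (gap_sym gm) (E6' _ _ in6 EB)) => x /=; clear; lia.
  by apply: (slide_head _ _ _ _ (U _ _) (gap_sym gb) (E6' _ _ in3 EB)) => x /=; clear; lia.
have e1 : weight I j ((t2, m1) |` ((m2, b2) |` B)) = weight I j ((t1, m1) |` ((m2, b2) |` B)).
  apply: (slide_tail t2 t1 m1 _ (U _ _) (gap_sym gt)) => [x /=|].
    by have := count_endpoints_fset1U (pred1 x) (m2, b2) B; rewrite /=; clear; lia.
  exact: (E6' _ _ in3 (EU (m2, b2) _ EB (E6 _ in4) (E6 _ in6))).
have e2 : weight I j ((t1, b2) |` ((m1, b1) |` B)) = weight I j ((t2, b2) |` ((m1, b1) |` B)).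
  apply: (slide_tail t1 t2 b2 _ (U _ _) gt) => [x /=|].
    by have := count_endpoints_fset1U (pred1 x) (m1, b1) B; rewrite /=; clear; lia.
  exact: (E6' _ _ in6 (EU (m1, b1) _ EB (E6 _ in3) (E6 _ in5))).
have e3 : weight I j ((t2, b2) |` ((m1, b1) |` B)) = weight I j ((t2, b2) |` ((m2, b1) |` B)).
  rewrite [X in weight _ _ X = _]fsetUCA [X in _ = weight _ _ X]fsetUCA.
  apply: (slide_tail m1 m2 b1 _ (U _ _) gm) => [x /=|].
    by have := count_endpoints_fset1U (pred1 x) (t2, b2) B; rewrite /=; clear; lia.
  exact: (E6' _ _ in5 (EU (t2, b2) _ EB (E6 _ in2) (E6 _ in6))).
(* The heads are the only parameters left: [m1], [b2] for the chain, then [b1], [b2] and [b2], [b1]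
   for the two orders on b. *)
have triangle := @weight_triangle _ B t2 m1 m2 b1 b2 _ gm.1 gb.1 ltm ltb _ _
  (fun p q => (t2, p) |` ((m2, q) |` B)) (fun _ _ => erefl _) I j jI.
have {}triangle : weight I j ((t2, m1) |` ((m2, b2) |` B)) +
    weight I j ((t2, b1) |` ((m2, b2) |` B)) = weight I j ((t2, b2) |` ((m2, b1) |` B)).
  apply: triangle.
  - by apply: U => x /=; clear; lia.
  - by move=> p Bp pm; have /andP[] := gm.2 p (EB _ Bp) pm.
  - by move=> p Bp pb; have /andP[] := gb.2 p (EB _ Bp) pb.
congruence.
Qed.

End Sliding.

(** * Sums over the sets of arrows of a Gauss diagram *)

Section PowersetSums.
Variables (K : choiceType) (V : nmodType).
Implicit Types (A T : {fset K}).

Lemma perm_fpowerset1U x A : x \notin A ->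
  perm_eq (fpowerset (x |` A)) (fpowerset A ++ [seq x |` T | T <- fpowerset A]).
Proof.
move=> Ax; have notin T : T `<=` A -> x \notin T by move=> /fsubsetP SA; apply: contra Ax => /SA.
have inj : {in fpowerset A &, injective (fun T => x |` T)}.
  by move=> T U; rewrite !fpowersetE => /notin Sx /notin Tx e; rewrite -(fsetU1K Sx) e fsetU1K.
apply: uniq_perm => [||T].
- exact: fset_uniq.
- rewrite cat_uniq map_inj_in_uniq // !fset_uniq andbT /=.
  apply/hasPn => _ /mapP[T _ ->]; rewrite fpowersetE; apply/negP => /fsubsetP/(_ x).
  by rewrite !inE eqxx (negPf Ax) => /(_ isT).
rewrite mem_cat !fpowersetE; apply/idP/orP => [SxA|[SA|/mapP[U + ->]]].
- have [Sx|Sx] := boolP (x \in T); [right|left].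
    apply/mapP; exists (T `\ x); last by rewrite fsetD1K.
    by rewrite fpowersetE fsubDset.
  by move: SxA; rewrite -fsubDset mem_fsetD1.
- exact: fsubset_trans SA (fsubsetU1 _ _).
- by rewrite fpowersetE => TA; apply: fsetUS.
Qed.

Lemma big_fpowerset1U x A (F : {fset K} -> V) : x \notin A ->
  \sum_(T <- fpowerset (x |` A)) F T = \sum_(T <- fpowerset A) (F T + F (x |` T)).
Proof.
by move=> Ax; rewrite (perm_big _ (perm_fpowerset1U Ax)) big_cat big_map big_split.
Qed.

Lemma eq_big_fpowerset A (F1 F2 : {fset K} -> V) :
  (forall T, T `<=` A -> F1 T = F2 T) ->
  \sum_(T <- fpowerset A) F1 T = \sum_(T <- fpowerset A) F2 T.
Proof. by move=> F12; apply: eq_big_seq => T; rewrite fpowersetE => /F12. Qed.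

Lemma big_fpowerset_imfset (g : K -> K) A (F : {fset K} -> V) : {in A &, injective g} ->
  \sum_(T <- fpowerset [fset g x | x in A]) F T =
  \sum_(T <- fpowerset A) F [fset g x | x in T].
Proof.
elim/fset1U_rect: A F => [|x A Ax IHA] F inj.
  by rewrite imfset0 fpowerset0 !big_seq_fset1 imfset0.
have injA : {in A &, injective g} by move=> y z Ay Az; apply: inj; rewrite !inE ?Ay ?Az orbT.
rewrite imfsetU1 !big_fpowerset1U //; last first.
  apply: contra Ax => /imfsetP[/= y Ay /inj e].
  by rewrite e // !inE ?eqxx // Ay orbT.
by rewrite (IHA (fun T => F T + F (g x |` T))) //; apply: eq_bigr => T _; rewrite imfsetU1.
Qed.

End PowersetSums.

(** * From pairings to sums of weights *)

Section Invariance.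
Variable n : nat.
Implicit Types (a b : arrow n) (x y : sarrow n) (p q : point n)
  (G : gauss n) (A : {fset arrow n}) (T K : {fset sarrow n}) (I : {set 'I_n}) (j : 'I_n).

Definition signed_endpoints (s : seq (sarrow n)) := endpoints [seq unsign x | x <- s].

Lemma uniq_of_endpoints (s : seq (arrow n)) : uniq (endpoints s) -> uniq s.
Proof.
elim: s => // a s IHs; rewrite endpoints_cons /= => /and3P[_ na /IHs->].
by rewrite andbT; apply: contra na => sa; rewrite (mem_endpoints sa).
Qed.

Lemma perm_forget T : uniq (signed_endpoints T) -> perm_eq (forget T) [seq unsign x | x <- T].
Proof. by move=> /uniq_of_endpoints/uniq_map_inj inj; apply: enum_imfset. Qed.

Lemma signed_endpoints_sub T K : T `<=` K ->
  perm_eq (signed_endpoints K) (signed_endpoints T ++ signed_endpoints (K `\` T)).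
Proof.
move=> TK; rewrite /signed_endpoints -[_ ++ _]flatten_cat -map_cat -map_cat.
apply/perm_endpoints/perm_map/uniq_perm; rewrite ?fset_uniq //.
  rewrite cat_uniq !fset_uniq /= andbT; apply/hasPn => x.
  by rewrite inE => /andP[].
move=> x; rewrite mem_cat inE; have /fsubsetP/(_ x) := TK.
by case: (x \in T) => // ->.
Qed.

Lemma uniq_endpoints_forget T K : T `<=` K -> uniq (signed_endpoints K) ->
  uniq (signed_endpoints T) /\ uniq (endpoints (forget T)).
Proof.
move=> TK; rewrite (perm_uniq (signed_endpoints_sub TK)) cat_uniq => /andP[uT _].
by split; rewrite // (perm_uniq (perm_endpoints (perm_forget uT))).
Qed.

Definition signed_weight I j T := weight I j (forget T) *~ \prod_(x <- T) sgnz x.2.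

Lemma signed_weight_fset1U I j x T : x \notin T -> signed_weight I j (x |` T) =
  weight I j (unsign x |` forget T) *~ (sgnz x.2 * \prod_(y <- T) sgnz y.2).
Proof. by move=> Tx; rewrite /signed_weight /forget imfsetU1 big_fsetU1. Qed.

Lemma weight_normal_form I j A : uniq (endpoints A) -> weight I j A =
  if planar_tree_diagram I j (normal_form A)
  then dias_class (monomial_of (tree_of (normal_form A) j)) *~ sign_diagram (normal_form A)
  else 0.
Proof.
move=> uA; rewrite -(weight_relabel uA (rank_monotone A)) -/(normal_form A).
rewrite /planar_tree_diagram /tree_diagram arrow_diagram_normal_form //= planarE.
rewrite -/(tree_shape I j (normal_form A)) /weight /planar_class.
by case: (tree_shape _ _ _) => //=; case: ifP; rewrite ?mul0rz.
Qed.

(** The strings that carry a tail determine the leaf set. So the union [all_planar_trees] merges no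
    diagrams, and a sum over [I] has at most one nonzero term. *)
Lemma planar_tree_diagram_leaves I I' j A :
  planar_tree_diagram I j A -> planar_tree_diagram I' j A -> I = I'.
Proof.
move=> /andP[/and3P[_ _ /andP[/forallP cI _]] _] /andP[/and3P[_ _ /andP[/forallP cI' _]] _].
apply/setP => i; move: (cI i) (cI' i) => /eqP-> ; by do 2!case: (_ \in _).
Qed.

Lemma sum_weight j A : uniq (endpoints A) ->
  \sum_(I : {set 'I_n} | j \notin I) weight I j A =
  if normal_form A \in all_planar_trees j
  then dias_class (monomial_of (tree_of (normal_form A) j)) *~ sign_diagram (normal_form A)
  else 0.
Proof.
move=> uA; under eq_bigr do rewrite weight_normal_form //.
case: ifP => [/bigfcupP[I /andP[_ jI]]|/negP no].
  rewrite in_planar_trees => ptd; rewrite (bigD1 I) //= ptd big1 ?addr0 // => I'.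
  case/andP=> _ /eqP ne; case: ifP => // ptd'; case: ne.
  exact: planar_tree_diagram_leaves ptd' ptd.
apply: big1 => I jI; case: ifP => // ptd; case: no; apply/bigfcupP; exists I.
  by rewrite mem_enum.
by rewrite in_planar_trees.
Qed.

(** After exchanging the sums, each set [T] of arrows meets at most one diagram, its normal form;
    summing weights over [I] gives exactly that term. *)
Lemma Z_sum j G : Z j G =
  \sum_(I : {set 'I_n} | j \notin I) \sum_(T <- fpowerset (garrows G)) signed_weight I j T.
Proof.
rewrite exchange_big /=.
transitivity (\sum_(T <- fpowerset (garrows G))
    \sum_(A <- all_planar_trees j | normal_form (forget T) == A)
      dias_class (monomial_of (tree_of A j)) *~ sign_diagram A *~ \prod_(x <- T) sgnz x.2).
  rewrite /Z; under [RHS]eq_bigr do rewrite big_mkcond.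
  rewrite exchange_big /=; apply: eq_bigr => A _.
  by rewrite -big_mkcond mulrzA /pairing mulrz_sumr.
apply/esym/eq_big_fpowerset => T TG.
have [_ uT] := uniq_endpoints_forget TG (gauss_uniq G).
transitivity ((\sum_(I : {set 'I_n} | j \notin I) weight I j (forget T)) *~
    \prod_(x <- T) sgnz x.2); first by rewrite mulrz_suml.
rewrite sum_weight //.
case: ifP => [nf|/negP nf].
  have one := filter_pred1_uniq (fset_uniq (all_planar_trees j)) nf.
  rewrite [RHS](eq_bigl (fun A => A == normal_form (forget T))) => [|A].
    by rewrite -[RHS]big_filter one big_seq1.
  exact: eq_sym.
rewrite mul0rz [RHS]big_seq_cond [RHS]big1 // => A /andP[+ /eqP e].
by rewrite -e => /nf.
Qed.

End Invariance.

(** * Reidemeister moves *)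

Section Moves.
Variable n : nat.
Implicit Types (x y : sarrow n) (p q : point n)
  (G : gauss n) (T K : {fset sarrow n}) (I : {set 'I_n}) (j : 'I_n).

Definition total_weight I j K := \sum_(T <- fpowerset K) signed_weight I j T.

Lemma mem_signed_endpoints (s : seq (sarrow n)) x : x \in s ->
  (tl (unsign x) \in signed_endpoints s) * (hd (unsign x) \in signed_endpoints s).
Proof. by move=> sx; apply/mem_endpoints/map_f. Qed.

Lemma signed_endpoints_fset1U x K : x \notin K ->
  perm_eq (signed_endpoints (x |` K))
    [:: tl (unsign x), hd (unsign x) & signed_endpoints K].
Proof.
move=> Kx; rewrite -endpoints_cons -[_ :: _]/(map (@unsign n) (x :: K)).
exact/perm_endpoints/perm_map/perm_fset1U.
Qed.

Lemma count_endpoints_forget T K p : T `<=` K -> uniq (signed_endpoints K) ->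
  (count_mem p (endpoints (forget T)) <= count_mem p (signed_endpoints K))%N.
Proof.
move=> TK uK; have [uT _] := uniq_endpoints_forget TK uK.
rewrite (permP (perm_endpoints (perm_forget uT))) (permP (signed_endpoints_sub TK)).
by rewrite count_cat leq_addr.
Qed.

Lemma mem_endpoints_forget T K : T `<=` K -> uniq (signed_endpoints K) ->
  {subset endpoints (forget T) <= signed_endpoints K}.
Proof.
move=> TK uK p; rewrite -!has_pred1 !has_count => lt.
exact: leq_trans lt (count_endpoints_forget p TK uK).
Qed.

Lemma adjacent_gap G p q : adjacent G p q -> gap (signed_endpoints G) p q.
Proof.
suff before p' q' : just_before G p' q' -> gap (signed_endpoints G) p' q'.
  by case/orP => [/before|/before/gap_sym].
case/and3P => /eqP e lt /hasPn no; split=> // r Gr rp.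
have := no r Gr; rewrite rp eqxx /= => ->.
by apply: contraTN lt => /andP[l1 l2]; rewrite -leqNgt ltnW // (ltn_trans l1).
Qed.

Lemma signed_weight_pos I j x T : x \notin T -> x.2 = true -> signed_weight I j (x |` T) =
  weight I j (unsign x |` forget T) *~ \prod_(y <- T) sgnz y.2.
Proof. by move=> Tx x2; rewrite signed_weight_fset1U // x2 mul1r. Qed.

Lemma total_weight_iso G G' I j : gauss_iso G G' -> total_weight I j G = total_weight I j G'.
Proof.
case=> f [strf monof G'E]; have mf : monotone_on (signed_endpoints G) f by [].
set g := fun x : sarrow n => ((f (tl (unsign x)), f (hd (unsign x))), x.2).
have inj : {in garrows G &, injective g}.
  move=> x y Gx Gy [tE hE sE].
  have [tx hx] := mem_signed_endpoints Gx; have [ty hy] := mem_signed_endpoints Gy.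
  have := monotone_on_inj mf tx ty tE; have := monotone_on_inj mf hx hy hE.
  by case: x y sE {Gx Gy tE hE tx hx ty hy} => -[? ?] ? [[? ?] ?]; rewrite /tl /hd /= => -> -> ->.
rewrite /total_weight G'E big_fpowerset_imfset //; apply: eq_big_fpowerset => T TG.
have [uT uF] := uniq_endpoints_forget TG (gauss_uniq G).
have sub : {in T &, injective g} by move=> x y /(fsubsetP TG) Gx /(fsubsetP TG); apply: inj.
rewrite /signed_weight big_imfset //=; congr (_ *~ _).
have -> : forget [fset g x | x in T] = relabel f (forget T).
  by rewrite /forget /relabel -!imfset_comp.
rewrite weight_relabel //; split=> // p q Fp Fq; apply: monof.
  exact: mem_endpoints_forget TG (gauss_uniq G) _ Fp.
exact: mem_endpoints_forget TG (gauss_uniq G) _ Fq.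
Qed.

Lemma total_weight_omega1 G G' I j : omega1 G G' -> total_weight I j G = total_weight I j G'.
Proof.
case=> x [G'x /adjacent_gap[loop _] GE]; rewrite /total_weight -(fsetD1K G'x) -GE.
have Gx : x \notin garrows G by rewrite GE in_fsetD1 eqxx.
rewrite big_fpowerset1U //; apply: eq_big_fpowerset => T /fsubsetP TG.
rewrite signed_weight_fset1U; last by apply: contra Gx; apply: TG.
by rewrite (@weight_loop _ _ _ _ (unsign x)) ?mul0rz ?addr0 // !inE eqxx.
Qed.

Lemma total_weight_omega2 G G' I j : omega2 G G' -> total_weight I j G = total_weight I j G'.
Proof.
case=> x [y [[G'x G'y] xy /adjacent_gap tl_gap /adjacent_gap hd_gap GE]].
have nxy : x != y by apply: contraNneq xy => ->.
have G'E : garrows G' = x |` (y |` garrows G).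
  apply/fsetP => z; rewrite GE !in_fset1U in_fsetD in_fset2.
  by case: eqP => [->|] //=; case: eqP => [->|].
have Gy : y \notin garrows G by rewrite GE in_fsetD in_fset2 eqxx orbT.
have Gx : x \notin y |` garrows G by rewrite GE in_fset1U in_fsetD in_fset2 (negPf nxy) eqxx.
have u := gauss_uniq G'; rewrite -/(signed_endpoints _) in u tl_gap hd_gap.
set E := signed_endpoints G' in u tl_gap hd_gap.
have EE : perm_eq E [:: tl (unsign x), hd (unsign x), tl (unsign y), hd (unsign y)
                      & signed_endpoints G].
  rewrite /E G'E (permPl (signed_endpoints_fset1U Gx)) !perm_cons.
  exact: signed_endpoints_fset1U.
have uG : uniq (signed_endpoints G).
  by move: u; rewrite (perm_uniq EE) (cat_uniq [:: _; _; _; _]) => /and3P[].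
rewrite /total_weight G'E !big_fpowerset1U //; apply: eq_big_fpowerset => T TG.
have Tx : x \notin y |` T by apply: contra Gx; apply/fsubsetP/fsetUS.
have Ty : y \notin T by apply: contra Gy; apply: (fsubsetP TG).
have Tx' : x \notin T by apply: contra Tx => Tx; rewrite in_fset1U Tx orbT.
have sub s : (forall p, count_mem p s <= count_mem p
    ([:: tl (unsign x); hd (unsign x); tl (unsign y); hd (unsign y)] ++
      endpoints (forget T)))%N -> uniq s.
  move=> le; apply: uniq_le_count u _ => p; apply: leq_trans (le p) _.
  by rewrite (permP EE) /= !leq_add2l count_endpoints_forget.
have xyE p : p \in [:: tl (unsign x); hd (unsign x); tl (unsign y); hd (unsign y)] ->
    {subset p :: endpoints (forget T) <= E}.
  move=> xyp q; rewrite (perm_mem EE) (mem_cat _ [:: _; _; _; _]) in_cons.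
  move=> /predU1P[->|/(mem_endpoints_forget TG uG)->]; last by rewrite orbT.
  by apply/orP; left.
have two_tails : signed_weight I j (x |` (y |` T)) = 0.
  rewrite signed_weight_fset1U //.
  rewrite (@weight_two_tails _ _ _ _ (unsign x) (unsign y)) ?mul0rz //.
  - by rewrite in_fset1U eqxx.
  - by rewrite in_fset1U /forget imfsetU1 in_fset1U eqxx orbT.
  - apply: contraTneq u => e; rewrite (perm_uniq EE) e /= !inE eqxx ?orbT.
    by rewrite ?andbF.
  - by case: tl_gap.
(* The tail of [x] slides to that of [y], then the head. Both target points are free because [y]
   itself is not in the set. *)
have swap : weight I j (unsign x |` forget T) = weight I j (unsign y |` forget T).
  have pairE (a : arrow n) : a = (tl a, hd a) by case: a.
  transitivity (weight I j ((tl (unsign y), hd (unsign x)) |` forget T)).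
    rewrite {1}[unsign x]pairE.
    apply: (weight_slide_tail I j (sub _ _) tl_gap (xyE _ _)) => [p /=|].
      by clear; lia.
    by rewrite !inE eqxx orbT.
  rewrite {2}[unsign y]pairE.
  apply: (weight_slide_head I j (sub _ _) hd_gap (xyE _ _)) => [p /=|].
    by clear; lia.
  by rewrite !inE eqxx !orbT.
have cancel : signed_weight I j (x |` T) + signed_weight I j (y |` T) = 0.
  have ex := etrans (signed_weight_fset1U I j Tx') (congr1 (fun w => w *~ _) swap).
  apply: etrans (congr2 +%R ex (signed_weight_fset1U I j Ty)) _.
  rewrite -mulrzDr -mulrDl.
  suff -> : sgnz x.2 + sgnz y.2 = 0 by rewrite mul0r.
  by case: x.2 y.2 xy => [] [].
by rewrite two_tails addr0 -addrA cancel addr0.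
Qed.

Lemma big_fpowerset3 (V : nmodType) x y z K (F : {fset sarrow n} -> V) :
  uniq [:: x; y; z] -> {in [:: x; y; z], forall w, w \notin K} ->
  \sum_(T <- fpowerset (x |` (y |` (z |` K)))) F T =
  \sum_(T <- fpowerset K)
    ((F T + F (x |` T) + (F (y |` T) + F (x |` (y |` T)))) +
     (F (z |` T) + F (x |` (z |` T)) +
      (F (y |` (z |` T)) + F (x |` (y |` (z |` T)))))).
Proof.
rewrite /= !inE negb_or !andbT => /andP[/andP[xy xz] yz] nK.
have [Kx Ky Kz] : [/\ x \notin K, y \notin K & z \notin K].
  by split; apply: nK; rewrite !inE eqxx ?orbT.
rewrite !big_fpowerset1U // !in_fset1U ?negb_or ?xy ?xz ?yz ?Kx ?Ky ?Kz //.
Qed.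

(** * The eight subsets of the three arrows *)

Section Triangle.
Variables (I : {set 'I_n}) (j : 'I_n) (t1 t2 m1 m2 b1 b2 : point n) (K : {fset sarrow n}).
Let E := [:: t1; t2; m1; m2; b1; b2] ++ signed_endpoints K.
Hypotheses (jI : j \notin I) (uE : uniq E)
  (gt : gap E t1 t2) (gm : gap E m1 m2) (gb : gap E b1 b2)
  (ltm : (pos m1 < pos m2)%N) (ltb : (pos b1 < pos b2)%N).

Let uK : uniq (signed_endpoints K).
Proof. by move: uE; rewrite cat_uniq => /and3P[]. Qed.

Lemma triangle_notin p q T : p \in [:: t1; t2; m1; m2; b1; b2] -> T `<=` K ->
  ((p, q), true) \notin T.
Proof.
move=> Ep /fsubsetP TK; apply/negP => /TK/mem_signed_endpoints[/= Kp _].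
by move: uE; rewrite cat_uniq => /and3P[_ /hasPn/(_ _ Kp)]; rewrite Ep.
Qed.

Lemma signed_weight_pos2 x y T : x \notin y |` T -> y \notin T ->
  x.2 = true -> y.2 = true -> signed_weight I j (x |` (y |` T)) =
  weight I j (unsign x |` (unsign y |` forget T)) *~ \prod_(z <- T) sgnz z.2.
Proof.
move=> xyT yT x2 y2; rewrite signed_weight_pos // big_fsetU1 //= y2 /= mul1r.
by rewrite /forget imfsetU1.
Qed.

(** Primes mark the arrows after the move: [a] is t -> m, [b] is t -> b, [c] is m -> b. Sets with
    [a] and [b], or their primed versions, have two tails on t; with [a'] and [c'] the head [m2]
    comes after the tail [m1]. *)
Lemma triangle_terms T : T `<=` K ->
  let w (s : seq (sarrow n)) := signed_weight I j (foldr (fun x A => x |` A) T s) in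
  let a := ((t1, m1), true) in let b := ((t2, b1), true) in let c := ((m2, b2), true) in
  let a' := ((t2, m2), true) in let b' := ((t1, b2), true) in let c' := ((m1, b1), true) in
  [/\ w [:: a] = w [:: a'], w [:: b] = w [:: b'], w [:: c] = w [:: c'],
      w [:: a; c] + w [:: b; c] = w [:: b'; c']
    & [/\ w [:: a; b] = 0, w [:: a; b; c] = 0, w [:: a'; b'] = 0,
          w [:: a'; c'] = 0 & w [:: a'; b'; c'] = 0]].
Proof.
move=> TK w a b c a' b' c'; rewrite /w /=.
have nE p q : p \in [:: t1; t2; m1; m2; b1; b2] -> ((p, q), true) \notin T.
  by move=> Ep; apply: triangle_notin TK.
have n2 p q p' q' : p \in [:: t1; t2; m1; m2; b1; b2] -> p != p' ->
    ((p, q), true) \notin ((p', q'), true) |` T.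
  by move=> Ep pp; rewrite in_fset1U !xpair_eqE (negPf pp) nE.
have uB : uniq ([:: t1; t2; m1; m2; b1; b2] ++ endpoints (forget T)).
  apply: uniq_le_count uE _ => p; rewrite !count_cat leq_add2l.
  exact: count_endpoints_forget.
have gapB p q : gap E p q -> gap ([:: t1; t2; m1; m2; b1; b2] ++ endpoints (forget T)) p q.
  apply: gapS => r; rewrite !mem_cat => /orP[->//|/(mem_endpoints_forget TK uK)->].
  by rewrite orbT.
have [ea eb ec eabc] := weight_omega3 jI uB (gapB _ _ gt) (gapB _ _ gm) (gapB _ _ gb) ltm ltb.
have vanish (A : {fset sarrow n}) : weight I j (forget A) = 0 -> signed_weight I j A = 0.
  by rewrite /signed_weight => ->; rewrite mul0rz.
have mem_forget x (A : {fset sarrow n}) : x \in A -> unsign x \in forget A.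
  by move=> Ax; apply/imfsetP; exists x.
have two (A : {fset sarrow n}) (p q r s : point n) : p != q -> str p = str q ->
    ((p, r), true) \in A -> ((q, s), true) \in A -> signed_weight I j A = 0.
  move=> pq e Ap Aq; have npq : (p, r) != (q, s) by rewrite xpair_eqE (negPf pq).
  exact: vanish (weight_two_tails I j (mem_forget _ _ Ap) (mem_forget _ _ Aq) npq e).
have late (A : {fset sarrow n}) : a' \in A -> c' \in A -> signed_weight I j A = 0.
  move=> Aa Ac; have sm : str m2 = str m1 by case: gm.
  exact: vanish (weight_late_head I j (mem_forget _ _ Ac) (mem_forget _ _ Aa) sm (ltnW ltm)).
have [i1 i2] : t1 \in [:: t1; t2; m1; m2; b1; b2] /\ t2 \in [:: t1; t2; m1; m2; b1; b2].
  by split; rewrite !inE eqxx ?orbT.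
have [i3 i4] : m1 \in [:: t1; t2; m1; m2; b1; b2] /\ m2 \in [:: t1; t2; m1; m2; b1; b2].
  by split; rewrite !inE eqxx ?orbT.
have [n1 n3] : t1 != t2 /\ t1 != m1.
  by split; apply: contraTneq uE => e; rewrite /E e /= !inE eqxx ?orbT ?andbF.
have [n4 n5] : t1 != m2 /\ t2 != m2.
  by split; apply: contraTneq uE => e; rewrite /E e /= !inE eqxx ?orbT ?andbF.
pose scale (v : Dias n) := v *~ \prod_(y <- T) sgnz y.2.
have single p q p' q' : ((p, q), true) \notin T -> ((p', q'), true) \notin T ->
    weight I j ((p, q) |` forget T) = weight I j ((p', q') |` forget T) ->
    signed_weight I j (((p, q), true) |` T) = signed_weight I j (((p', q'), true) |` T).
  move=> pT qT e; apply: etrans (signed_weight_pos I j pT erefl) _.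
  apply: etrans (congr1 scale e) _; apply: esym; exact: signed_weight_pos.
split.
- by apply: (single _ _ _ _ (nE _ _ i1) (nE _ _ i2) ea).
- by apply: (single _ _ _ _ (nE _ _ i2) (nE _ _ i1) eb).
- by apply: (single _ _ _ _ (nE _ _ i4) (nE _ _ i3) ec).
- apply: etrans (congr2 +%R (signed_weight_pos2 (n2 _ _ _ _ i1 n4) (nE _ _ i4) erefl erefl)
    (signed_weight_pos2 (n2 _ _ _ _ i2 n5) (nE _ _ i4) erefl erefl)) _.
  apply: etrans _ (esym (signed_weight_pos2 (n2 _ _ _ _ i1 n3) (nE _ _ i3) erefl erefl)).
  by apply: etrans (congr1 scale eabc); apply: esym; apply: mulrzDl.
have st : str t1 = str t2 by case: gt.
split.
- by apply: (two _ t1 t2 m1 b1 n1 st); rewrite !in_fset1U eqxx ?orbT.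
- by apply: (two _ t1 t2 m1 b1 n1 st); rewrite !in_fset1U eqxx ?orbT.
- by apply: (two _ t1 t2 b2 m2 n1 st); rewrite !in_fset1U eqxx ?orbT.
- by apply: late; rewrite !in_fset1U eqxx ?orbT.
- by apply: late; rewrite !in_fset1U eqxx ?orbT.
Qed.

Lemma total_weight_triangle :
  total_weight I j (((t1, m1), true) |` (((t2, b1), true) |` (((m2, b2), true) |` K))) =
  total_weight I j (((t2, m2), true) |` (((t1, b2), true) |` (((m1, b1), true) |` K))).
Proof.
have nE p q : p \in [:: t1; t2; m1; m2; b1; b2] -> ((p, q), true) \notin K.
  by move=> Ep; apply: triangle_notin.
(* The summands follow [big_fpowerset3]: [d] and [e] are the weights of the pairs [a], [c] and [b],
   [c], and their sum reappears as the weight of [b'], [c']. *)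
have sum8 (V : zmodType) (f a b c d e : V) :
    f + a + (b + 0) + (c + d + (e + 0)) = f + a + (b + 0) + (c + 0 + (d + e + 0)).
  by rewrite !addr0 -(addrA c).
have distinct (p1 p2 p3 q1 q2 q3 : point n) : uniq [:: p1; p2; p3] ->
    uniq [:: ((p1, q1), true); ((p2, q2), true); ((p3, q3), true)].
  rewrite /= !inE !negb_or !andbT => /andP[/andP[p12 p13] p23].
  by rewrite !xpair_eqE (negPf p12) (negPf p13) (negPf p23).
have notinK (p1 p2 p3 q1 q2 q3 : point n) :
    {subset [:: p1; p2; p3] <= [:: t1; t2; m1; m2; b1; b2]} ->
    {in [:: ((p1, q1), true); ((p2, q2), true); ((p3, q3), true)], forall w, w \notin K}.
  move=> sub w; rewrite !inE => /or3P[] /eqP->; apply: nE; apply: sub;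
    by rewrite !inE eqxx ?orbT.
apply: etrans (big_fpowerset3 _ (distinct _ _ _ _ _ _ _) (notinK _ _ _ _ _ _ _)) _.
- by apply: uniq_le_count uE _ => p; rewrite /E /=; clear; lia.
- by apply/allP; rewrite /= !inE !eqxx !orbT.
apply: etrans (esym (big_fpowerset3 _ (distinct _ _ _ _ _ _ _) (notinK _ _ _ _ _ _ _))).
- apply: eq_big_fpowerset => T /triangle_terms[/= ea eb ec eabc [e1 e2 e3 e4 e5]].
  apply: etrans (congr2 +%R (congr2 +%R (congr1 _ ea) (congr2 +%R eb e1))
    (congr2 +%R (congr2 +%R ec erefl) (congr1 _ e2))) _.
  apply: etrans _ (esym (congr2 +%R (congr1 _ (congr1 _ e3))
    (congr2 +%R (congr1 _ e4) (congr2 +%R (esym eabc) e5)))).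
  exact: sum8.
- by apply: uniq_le_count uE _ => p; rewrite /E /=; clear; lia.
- by apply/allP; rewrite /= !inE !eqxx !orbT.
Qed.

End Triangle.

Lemma just_before_gap G p q : just_before G p q ->
  gap (signed_endpoints G) p q /\ (pos p < pos q)%N.
Proof. by move=> pq; split; [apply: adjacent_gap; apply/orP; left|case/and3P: pq]. Qed.

Lemma pair_endpoints_uniq K x y : x \in K -> y \in K -> x != y ->
  uniq (signed_endpoints K) ->
  uniq [:: tl (unsign x); hd (unsign x); tl (unsign y); hd (unsign y)].
Proof.
move=> Kx Ky xy uK; have sub : x |` [fset y] `<=` K by rewrite fsubUset !fsub1set Kx.
have [+ _] := uniq_endpoints_forget sub uK.
rewrite (perm_uniq (signed_endpoints_fset1U _)) ?in_fset1 // => u.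
apply: uniq_le_count u _ => p; rewrite /= !leq_add2l.
rewrite -[[fset y]]fsetU0 (permP (signed_endpoints_fset1U _)) ?in_fset0 //= !leq_add2l.
Qed.

(** [B] is the rest common to both diagrams; subsets before and after the move are matched over
    it. *)
Lemma fset3_exchange (V : choiceType) (A A' : {fset V}) (x y z x' y' z' : V) :
  [fset x; y; z] `<=` A -> A' = (A `\` [fset x; y; z]) `|` [fset x'; y'; z'] ->
  exists2 B : {fset V}, A = x |` (y |` (z |` B)) /\ A' = x' |` (y' |` (z' |` B))
    & [/\ x \notin B, y \notin B & z \notin B].
Proof.
move=> sub ->; exists (A `\` [fset x; y; z]).
  split; last by rewrite fsetUC -!fsetUA.
  by rewrite -[LHS](fsetID [fset x; y; z]) (fsetIidPr sub) -!fsetUA.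
by split; rewrite in_fsetD !in_fsetU !in_fset1 eqxx ?orbT.
Qed.

Lemma total_weight_omega3 G G' I j : j \notin I -> omega3 G G' ->
  total_weight I j G = total_weight I j G'.
Proof.
move=> jI [t1 [t2 [m1 [m2 [b1 [b2 [sub [tb mb bb] G'E]]]]]]].
have [gt ltt] := just_before_gap tb; have [gm ltm] := just_before_gap mb.
have [gb ltb] := just_before_gap bb.
have neq p q : (pos p < pos q)%N -> p != q by apply: contraTneq => ->; rewrite ltnn.
have [K [GE {}G'E] [nx ny nz]] := fset3_exchange sub G'E.
have t12 : t1 != t2 by exact: neq.
have xy : ((t1, m1), true) != ((t2, b1), true) by rewrite !xpair_eqE (negPf t12).
have yz : ((t2, b1), true) != ((m2, b2), true).
  by rewrite !xpair_eqE (negPf (neq _ _ ltb)) andbF.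
have xz : ((t1, m1), true) != ((m2, b2), true).
  (* The three displayed arrows might coincide as elements of a set. If [t1] were [m2], the distinct
     arrows from [t2] to [m2] and from [t1] to [b2] in [G'] would share an endpoint. *)
  apply/negP; rewrite !xpair_eqE => /andP[/andP[/eqP tm _] _].
  have := @pair_endpoints_uniq _ ((t2, m2), true) ((t1, b2), true) _ _ _ (gauss_uniq G').
  rewrite -/(garrows G') G'E !in_fset1U !eqxx orbT !xpair_eqE eq_sym (negPf t12).
  by move/(_ isT isT isT); rewrite /= !inE tm eqxx ?orbT /= andbF.
have x_notin : ((t1, m1), true) \notin ((t2, b1), true) |` (((m2, b2), true) |` K).
  by rewrite !in_fset1U (negPf xy) (negPf xz).
have y_notin : ((t2, b1), true) \notin ((m2, b2), true) |` K.
  by rewrite in_fset1U (negPf yz).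
have u := gauss_uniq G; rewrite -/(signed_endpoints _) in u gt gm gb.
(* Once the three arrows are distinct, their six endpoints and those of the rest exhaust the
   endpoints of [G] with multiplicity, which makes them distinct. *)
have EE p : count_mem p ([:: t1; t2; m1; m2; b1; b2] ++ signed_endpoints K) =
    count_mem p (signed_endpoints G).
  rewrite GE (permP (signed_endpoints_fset1U x_notin)) /=.
  rewrite (permP (signed_endpoints_fset1U y_notin)) /=.
  rewrite (permP (signed_endpoints_fset1U nz)) /=.
  by clear; lia.
have subE : {subset [:: t1; t2; m1; m2; b1; b2] ++ signed_endpoints K
    <= signed_endpoints G}.
  by move=> p; rewrite -!has_pred1 !has_count EE.
rewrite GE G'E; apply: total_weight_triangle => //; try exact: gapS subE _.
by apply: uniq_le_count u _ => p; rewrite EE.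
Qed.

End Moves.

Theorem theorem3p3 (n : nat) (j : 'I_n) (G G' : gauss n) :
  reidemeister G G' -> Z j G = Z j G'.
Proof.
have total_step (I : {set 'I_n}) (H H' : gauss n) : j \notin I ->
    reidemeister_step H H' -> total_weight I j H = total_weight I j H'.
  move=> jI [].
  - exact: total_weight_iso.
  - exact: total_weight_omega1.
  - exact: total_weight_omega2.
  - exact: total_weight_omega3.
elim=> {G G'} [G G' step| |G G' _ //|G G' G'' _ -> _ ->] //.
by rewrite !Z_sum; apply: eq_bigr => I jI; apply: total_step.
Qed.
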